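(* Let $\pi$ be a given stationary density on $(x_1,x_2)$ and let $\widehat{\sigma}^2/2>0$ be a given average variance. Put $m_1=\int_{x_1}^{x_2}x\,\pi(x)\,dx$, $m_2=\int_{x_1}^{x_2}x^2\pi(x)\,dx$ and $\Pi(x)=\int_{x_1}^x\pi(z)\,dz$. Consider all reversible diffusion processes with stationary density $\pi$ whose variance function $\frac12\sigma^2$ is admissible, i.e. in particular satisfies $\int_{x_1}^{x_2}\frac12\sigma^2(x)\pi(x)\,dx=\frac12\widehat{\sigma}^2$. Then the maximum over this class of the convergence rate $\lambda_1[\sigma^2]$ is attained, and the optimal convergence rate $\lambda_1$ and optimal relaxation time $\tau=1/\lambda_1$ are $$\lambda_1=\frac{\widehat{\sigma}^2}{2(m_2-m_1^2)},\qquad \tau=\frac{2(m_2-m_1^2)}{\widehat{\sigma}^2}.$$ The optimal diffusion has drift function $$\mu(x)=\frac{\widehat{\sigma}^2(m_1-x)}{2(m_2-m_1^2)},$$ variance function $$\frac12\sigma^2(x)=\frac{1}{\pi(x)}\cdot\frac{\widehat{\sigma}^2}{2(m_2-m_1^2)}\left((m_1-x)\Pi(x)+\int_{x_1}^x\Pi(z)\,dz\right),$$ and the normalized eigenfunction corresponding to its eigenvalue $\lambda_1$ is (up to sign) $$\phi_1(x)=\frac{x-m_1}{\sqrt{m_2-m_1^2}}.$$ In particular, $\frac{\widehat{\sigma}^2}{2(m_2-m_1^2)}$ is an upper bound on the convergence rate of every such diffusion process with stationary density $\pi$ and average variance $\widehat{\sigma}^2/2$.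
   Context: Let $-\infty\le x_1<x_2\le\infty$. The stationary density $\pi$ is a continuous, strictly positive probability density on $(x_1,x_2)$ with finite second moment. A time-homogeneous diffusion $dX(t)=\mu(X(t))\,dt+\sigma(X(t))\,dW(t)$ on $(x_1,x_2)$, with $W$ a Brownian motion and reflecting boundary conditions, is reversible with respect to $\pi$ if the detailed balance condition $-\mu\pi+\frac12(\sigma^2\pi)'=0$ holds, that is, $\mu(x)=\frac{1}{2\pi(x)}\frac{d}{dx}\bigl(\sigma^2(x)\pi(x)\bigr)$; so the drift is determined by $\pi$ and $\sigma^2$. The function $\mu$ is called the drift function and $\frac12\sigma^2$ the variance function. The associated Sturm-Liouville problem is $$\frac12\frac{d}{dx}\left(\pi(x)\sigma^2(x)\frac{d\phi}{dx}(x)\right)+\lambda\,\pi(x)\phi(x)=0,\qquad \frac12\sigma^2(x)\pi(x)\phi'(x)\to0\ \text{ as }x\to x_1\text{ and }x\to x_2,$$ with eigenfunctions normalized by $\int_{x_1}^{x_2}\pi\phi^2\,dx=1$. It always has the eigenvalue $\lambda_0=0$ with $\phi_0=1$. The convergence rate $\lambda_1=\lambda_1[\sigma^2]$ is the next eigenvalue; it governs the convergence of the transition density $p(t;x,y)$ to $\pi(y)$ and is given by the Rayleigh principle $$\lambda_1[\sigma^2]=\min_Q\int_{x_1}^{x_2}\frac12\sigma^2(x)\pi(x)\,Q'(x)^2\,dx,$$ where $Q$ ranges over continuously differentiable functions on $(x_1,x_2)$ with $\int\pi Q^2\,dx=1$, $\int\pi Q\,dx=0$ and $\frac12\sigma^2\pi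 Q'\to0$ at $x_1$ and $x_2$. A variance function $\frac12\sigma^2$ is admissible if $\sigma^2>0$ on $(x_1,x_2)$, $\sigma^2\pi$ is continuously differentiable on $(x_1,x_2)$, the average variance constraint $\int_{x_1}^{x_2}\frac12\sigma^2\pi\,dx=\frac12\widehat{\sigma}^2$ holds, and the eigenvalue $\lambda_1[\sigma^2]$ exists, i.e. the minimum of $\int_{x_1}^{x_2}\frac12\sigma^2(x)\pi(x)\,Q'(x)^2\,dx$ over all continuously differentiable functions $Q$ on $(x_1,x_2)$ with $\int\pi Q^2\,dx=1$, $\int\pi Q\,dx=0$ and $\frac12\sigma^2\pi Q'\to0$ at $x_1$ and $x_2$ is attained. The relaxation time is $1/\lambda_1$. *)

(* Defs.v *)
From HB Require Import structures.
From mathcomp Require Import all_boot all_order all_algebra.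
From mathcomp Require Import all_classical all_reals all_analysis.

Set Implicit Arguments.
Unset Strict Implicit.
Unset Printing Implicit Defensive.

Import Order.TTheory GRing.Theory Num.Theory.
Import numFieldNormedType.Exports.

Local Open Scope classical_set_scope.
Local Open Scope ring_scope.

(* Functions on (x1, x2) are total functions R -> R of which only the values  *)
(* on (x1, x2) matter.                                                        *)
Definition oint {R : realType} (x1 x2 : \bar R) : set R :=
  [set x | (x1 < x%:E < x2)%E].

(* Junk value at x1 = +oo, which x1 < x2 excludes.                            *)
Definition to_left_end {R : realType} (x1 : \bar R) : set_system R :=
  if x1 is (a%:E)%E then a^'+ else -oo.

(* Junk value at x2 = -oo, which x1 < x2 excludes.                            *)
Definition to_right_end {R : realType} (x2 : \bar R) : set_system R :=
  if x2 is (b%:E)%E then b^'- else +oo.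

Definition continuous_on {R : realType} (I : set R) (f : R -> R) : Prop :=
  forall x, I x -> {for x, continuous f}.

Definition continuously_differentiable_on {R : realType} (I : set R)
    (f : R -> R) : Prop :=
  (forall x, I x -> derivable f x 1) /\ continuous_on I (derive1 f).

Definition stationary_density {R : realType} (x1 x2 : \bar R) (p : R -> R) :
    Prop :=
  [/\ continuous_on (oint x1 x2) p,
      (forall x, oint x1 x2 x -> 0 < p x),
      (\int[lebesgue_measure]_(x in oint x1 x2) (p x)%:E = 1)%E &
      (\int[lebesgue_measure]_(x in oint x1 x2) (x ^+ 2 * p x)%:E < +oo)%E].

Definition moment {R : realType} (x1 x2 : \bar R) (p : R -> R) (k : nat) : R :=
  \int[lebesgue_measure]_(x in oint x1 x2) (x ^+ k * p x).

(* The integral of f from the (possibly infinite) left endpoint x1 to x.      *)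
Definition integral_from {R : realType} (x1 : \bar R) (f : R -> R) (x : R) : R :=
  \int[lebesgue_measure]_(z in [set z : R | (x1 < z%:E <= x%:E)%E]) f z.

(* The diffusion dX = drift(X) dt + sigma(X) dW on (x1, x2), reflected at the *)
(* ends, is represented by its coefficients; the reflection enters through    *)
(* the zero-flux conditions below.                                            *)
Record diffusion (R : realType) := Diffusion {
  drift : R -> R;
  sigma : R -> R
}.

Definition variance_function {R : realType} (d : diffusion R) (x : R) : R :=
  2^-1 * sigma d x ^+ 2.

Definition reversible {R : realType} (x1 x2 : \bar R) (p : R -> R)
    (d : diffusion R) : Prop :=
  forall x, oint x1 x2 x ->
    - drift d x * p x + 2^-1 * derive1 (fun y => sigma d y ^+ 2 * p y) x = 0.

Definition flux {R : realType} (p : R -> R) (d : diffusion R) (Q : R -> R)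
    (x : R) : R :=
  2^-1 * sigma d x ^+ 2 * p x * derive1 Q x.

Definition zero_flux {R : realType} (x1 x2 : \bar R) (p : R -> R)
    (d : diffusion R) (Q : R -> R) : Prop :=
  flux p d Q @ to_left_end x1 --> (0 : R) /\
  flux p d Q @ to_right_end x2 --> (0 : R).

Definition normalized {R : realType} (x1 x2 : \bar R) (p : R -> R)
    (Q : R -> R) : Prop :=
  (\int[lebesgue_measure]_(x in oint x1 x2) (p x * Q x ^+ 2)%:E = 1)%E.

(* Solutions of (1/2) (p sigma^2 phi')' + l p phi = 0 with zero flux at both  *)
(* ends and unit norm in L^2(p); unit norm excludes phi = 0.                  *)
Definition normalized_eigenfunction {R : realType} (x1 x2 : \bar R)
    (p : R -> R) (d : diffusion R) (l : R) (phi : R -> R) : Prop :=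
  [/\ (forall x, oint x1 x2 x -> derivable phi x 1),
      (forall x, oint x1 x2 x ->
         derivable (fun y => p y * sigma d y ^+ 2 * derive1 phi y) x 1),
      (forall x, oint x1 x2 x ->
         2^-1 * derive1 (fun y => p y * sigma d y ^+ 2 * derive1 phi y) x
           + l * p x * phi x = 0),
      zero_flux x1 x2 p d phi &
      normalized x1 x2 p phi].

Definition eigenvalue {R : realType} (x1 x2 : \bar R) (p : R -> R)
    (d : diffusion R) (l : R) : Prop :=
  exists phi, normalized_eigenfunction x1 x2 p d l phi.

(* l is the next eigenvalue after the eigenvalue 0.                           *)
Definition next_eigenvalue {R : realType} (x1 x2 : \bar R) (p : R -> R)
    (d : diffusion R) (l : R) : Prop :=
  [/\ 0 < l, eigenvalue x1 x2 p d l &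
      forall l', eigenvalue x1 x2 p d l' -> 0 < l' -> l <= l'].

Definition rayleigh_competitor {R : realType} (x1 x2 : \bar R) (p : R -> R)
    (d : diffusion R) (Q : R -> R) : Prop :=
  [/\ continuously_differentiable_on (oint x1 x2) Q,
      normalized x1 x2 p Q,
      (\int[lebesgue_measure]_(x in oint x1 x2) (p x * Q x)%:E = 0)%E &
      zero_flux x1 x2 p d Q].

(* Extended-real valued, since the integral may be +oo.                       *)
Definition rayleigh {R : realType} (x1 x2 : \bar R) (p : R -> R)
    (d : diffusion R) (Q : R -> R) : \bar R :=
  (\int[lebesgue_measure]_(x in oint x1 x2)
     (2^-1 * sigma d x ^+ 2 * p x * (derive1 Q x) ^+ 2)%:E)%E.

(* l = lambda_1[sigma^2]: the minimum in the Rayleigh principle is attained   *)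
(* and equals l. This determines l.                                           *)
Definition convergence_rate {R : realType} (x1 x2 : \bar R) (p : R -> R)
    (d : diffusion R) (l : R) : Prop :=
  (exists2 Q, rayleigh_competitor x1 x2 p d Q
            & rayleigh x1 x2 p d Q = l%:E) /\
  (forall Q, rayleigh_competitor x1 x2 p d Q ->
     (l%:E <= rayleigh x1 x2 p d Q)%E).

Definition relaxation_time {R : realType} (l : R) : R := l^-1.

(* sh2 is the constant \hat\sigma^2, twice the prescribed average variance.   *)
Definition admissible {R : realType} (x1 x2 : \bar R) (p : R -> R) (sh2 : R)
    (d : diffusion R) : Prop :=
  [/\ (forall x, oint x1 x2 x -> 0 < sigma d x ^+ 2),
      continuously_differentiable_on (oint x1 x2)
        (fun x => sigma d x ^+ 2 * p x),
      (\int[lebesgue_measure]_(x in oint x1 x2)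
         (variance_function d x * p x)%:E = (2^-1 * sh2)%:E)%E &
      exists l, convergence_rate x1 x2 p d l].

(* d attains the maximum of the convergence rate over all reversible          *)
(* diffusions with stationary density p and admissible variance function,     *)
(* and l is that maximum.                                                     *)
Definition optimal_diffusion {R : realType} (x1 x2 : \bar R) (p : R -> R)
    (sh2 : R) (d : diffusion R) (l : R) : Prop :=
  [/\ reversible x1 x2 p d, admissible x1 x2 p sh2 d,
      convergence_rate x1 x2 p d l &
      forall d' l', reversible x1 x2 p d' -> admissible x1 x2 p sh2 d' ->
        convergence_rate x1 x2 p d' l' -> l' <= l].

(* Main.v *)
Require Import Defs.
From HB Require Import structures.
From mathcomp Require Import all_boot all_order all_algebra.
From mathcomp Require Import all_classical all_reals all_analysis.
From mathcomp Require Import measurable_realfun.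
From mathcomp Require Import ring lra.
Import Order.TTheory GRing.Theory Num.Theory.
Import numFieldNormedType.Exports.
Local Open Scope classical_set_scope.
Local Open Scope ring_scope.
Set Implicit Arguments.
Unset Strict Implicit.
Unset Printing Implicit Defensive.

(** Write [a = sigma^2 p / 2] for the conductance of a diffusion, [m1] and [V] for
    the mean and the variance of [p], and [K = sh2 / (2 V)].

    Upper bound. If [l] is the rate, then [l Var(Q)] is at most the integral of
    [a Q'^2] for every test function [Q] with zero flux at the ends. For [Q x = x] the derivative is 1 and the
    inequality reads [l V <= sh2 / 2], that is [l <= K]. The flux of this function
    need not vanish at the ends, so it is not a competitor in the Rayleigh principle;
    [rayleigh_variance] extends the inequality to it by composing test functions with
    continuously differentiable clamps of the identity and passing to the limit.

    Attainment. Equality requires [x - m1] to be an eigenfunction, which means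
    [a' = K (m1 - x) p]; hence [a = K G], where [G] ([optimal_weight]) is the integral
    of [(m1 - z) p z] from [x1] to [x]. This function is positive and vanishes at both
    ends, so it defines a diffusion. That its rate is [K] is a Poincare inequality
    with weight [G] ([poincare]). For [q = Q - Q m1] and the secant slope
    [r = q / (x - m1)] one has
      [(G r^2 (x - m1))' = G Q'^2 - p q^2 - G (Q' - r)^2],
    and the differentiated function has the sign of [x - m1]. Integrating over
    segments around [m1] gives the inequality, without boundary conditions and with an
    explicit defect that identifies the extremal functions.

    Uniqueness of the coefficients. If the integral of [a] is [K V] and the rate is
    [K], then the identity minimizes the difference of both sides of the inequality
    of the first step. Its first variation ([first_variation]) determines the integral
    of [a] against every bump function, hence [a] ([conductance_unique]). So every
    optimal diffusion has conductance [K G], and detailed balance gives its drift. The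
    displayed formula for [G] is an integration by parts ([optimal_weightE]).

    Spectrum. An eigenfunction [phi] with eigenvalue [l > 0] has mean zero, and its
    Rayleigh integral is at most [l] ([eigenfunction_energy]); so the Poincare
    inequality gives [K <= l]. For [l = K] the defect vanishes, which forces [phi] to
    be proportional to [x - m1]. *)

(** * Integrals and derivatives on the line *)

Section Line.
Variable R : realType.
Notation mu := (@lebesgue_measure R).

Lemma ge0_integral_cvg_sets (D : set R) (E : nat -> set R) (f : R -> \bar R) :
  measurable D -> (forall n, measurable (E n)) -> nondecreasing_seq E ->
  (forall n, E n `<=` D) -> (forall x, D x -> exists n, E n x) ->
  measurable_fun D f -> (forall x, D x -> 0 <= f x)%E ->
  (\int[mu]_(x in E n) f x @[n --> \oo] --> \int[mu]_(x in D) f x)%E.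
Proof.
move=> mD mE ndE ED DE mf f0.
have -> : D = \bigcup_n E n.
  by apply/seteqP; split => [x /DE[n Enx]|x [n _ /ED]//]; exists n.
apply: ge0_nondecreasing_set_cvg_integral => //.
- by move=> n; exact: measurable_funS mf.
- by move=> n x /ED; exact: f0.
Qed.

Lemma Rintegral_dominated_cvg (D : set R) (f_ : nat -> R -> R) (f g : R -> R) :
  measurable D -> (forall n, measurable_fun D (f_ n)) -> measurable_fun D f ->
  (forall x, D x -> f_ n x @[n --> \oo] --> f x) ->
  mu.-integrable D (EFin \o g) ->
  (forall n x, D x -> `|f_ n x| <= g x) ->
  \int[mu]_(x in D) f_ n x @[n --> \oo] --> \int[mu]_(x in D) f x.
Proof.
move=> mD mf_ mf ff intg fg.
have [|||||intf _ cvgf] := @dominated_convergence _ _ _ mu D mD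
    (fun n => EFin \o f_ n) (EFin \o f) (EFin \o g) => //.
- by move=> n; apply/measurable_EFinP; exact: mf_.
- by apply/measurable_EFinP.
- by apply/aeW => x Dx; apply: cvg_EFin; [exact: nearW|exact: ff].
- by apply/aeW => x n Dx; rewrite /= lee_fin; exact: fg.
apply: fine_cvg; rewrite fineK; last exact: integrable_fin_num.
exact: cvgf.
Qed.

Lemma Rintegral_cvg_sets (D : set R) (E : nat -> set R) (f : R -> R) :
  measurable D -> (forall n, measurable (E n)) -> (forall n, E n `<=` D) ->
  (forall x, D x -> \forall n \near \oo, E n x) ->
  mu.-integrable D (EFin \o f) ->
  (\int[mu]_(x in E n) f x) @[n --> \oo] --> \int[mu]_(x in D) f x.
Proof.
move=> mD mE ED nE fi.
have mf : measurable_fun D f by apply/measurable_EFinP; exact: measurable_int fi.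
have e n : \int[mu]_(x in E n) f x = \int[mu]_(x in D) (f \_ (E n)) x.
  by rewrite -Rintegral_mkcondr setIidr.
rewrite (funext e); apply: (@Rintegral_dominated_cvg _ _ _ (fun x => `|f x|)) => //.
- move=> n; apply/(measurable_restrict f) => //.
  by apply: measurable_funS mf => // x [].
- move=> x Dx; apply: cvg_near_cst; apply: filterS (nE x Dx) => n Enx.
  by rewrite patchE mem_set.
- by rewrite (_ : _ \o _ = (fun x => `|(f x)%:E|)%E)//; exact: integrable_norm.
- by move=> n x _; rewrite patchE; case: ifP => // _; rewrite normr0.
Qed.

Lemma integrable_scale (D : set R) (c : R) (f : R -> R) : measurable D ->
  mu.-integrable D (EFin \o f) -> mu.-integrable D (EFin \o (fun x => c * f x)).
Proof.
move=> mD fi; rewrite (_ : _ \o _ = (fun x => c%:E * (f x)%:E))%E//.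
exact: integrableZl.
Qed.

Lemma integrable_add (D : set R) (f g : R -> R) : measurable D ->
  mu.-integrable D (EFin \o f) -> mu.-integrable D (EFin \o g) ->
  mu.-integrable D (EFin \o (fun x => f x + g x)).
Proof.
move=> mD fi gi; rewrite (_ : _ \o _ = (fun x => (f x)%:E + (g x)%:E))%E//.
exact: integrableD.
Qed.

Lemma continuous_sqr (f : R -> R) (x : R) :
  {for x, continuous f} -> {for x, continuous (fun y => f y ^+ 2)}.
Proof. by move=> cf; have := continuousM cf cf. Qed.

Lemma is_derive_continuous (f : R -> R) (x df : R) :
  is_derive x 1 f df -> {for x, continuous f}.
Proof. by move=> [df' _]; apply: differentiable_continuous; apply/derivable1_diffP. Qed.

Lemma integral_EFin_Rintegral (D : set R) (f : R -> R) : measurable D ->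
  mu.-integrable D (EFin \o f) ->
  (\int[mu]_(x in D) (f x)%:E = (\int[mu]_(x in D) f x)%:E)%E.
Proof. by move=> mD fi; rewrite /Rintegral fineK//; exact: integrable_fin_num. Qed.

Lemma integrable_mul_bounded (D : set R) (a f : R -> R) (C : R) : measurable D ->
  mu.-integrable D (EFin \o a) -> measurable_fun D f -> (forall x, D x -> `|f x| <= C) ->
  mu.-integrable D (EFin \o (fun x => a x * f x)).
Proof.
move=> mD ai mf fC.
have ma : measurable_fun D a by apply/measurable_EFinP; exact: measurable_int ai.
apply: (@le_integrable _ _ _ mu D mD _ (EFin \o (fun x => C * a x))).
- by apply/measurable_EFinP; exact: measurable_funM.
- move=> x Dx /=; rewrite lee_fin !normrM mulrC.
  apply: ler_wpM2r => //; exact: le_trans (fC _ Dx) (ler_norm _).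
- exact: integrable_scale.
Qed.

Lemma continuous_itv_within (f : R -> R) (a b : R) :
  (forall x, a <= x <= b -> {for x, continuous f}) -> {within `[a, b], continuous f}.
Proof.
by move=> cf; apply: continuous_in_subspaceT => x; rewrite inE /= in_itv /=; exact: cf.
Qed.

Lemma continuous_itv_integrable (f : R -> R) (a b : R) :
  (forall x, a <= x <= b -> {for x, continuous f}) ->
  mu.-integrable `[a, b] (EFin \o f).
Proof.
move=> cf; apply: continuous_compact_integrable; first exact: segment_compact.
exact: continuous_itv_within.
Qed.

Lemma Rintegral_FTC2 (f F : R -> R) (a b : R) : a <= b ->
  (forall x, a <= x <= b -> {for x, continuous f}) ->
  (forall x, a <= x <= b -> {for x, continuous F}) ->
  (forall x, a < x < b -> is_derive x 1 F (f x)) ->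
  \int[mu]_(x in `[a, b]) f x = F b - F a.
Proof.
rewrite le_eqVlt => /predU1P[<- _ _ _|ab cf cF dF].
  by rewrite subrr set_itv1 Rintegral_set1.
rewrite /Rintegral (@continuous_FTC2 R f F)//.
- exact: continuous_itv_within.
- split.
  + by move=> x; rewrite in_itv /= => /dF [].
  + by apply: cvg_at_right_filter; apply: cF; rewrite lexx ltW.
  + by apply: cvg_at_left_filter; apply: cF; rewrite lexx ltW.
- by move=> x; rewrite in_itv /= => /dF h; rewrite derive1E derive_val.
Qed.

Lemma Rintegral_gt0 (D : set R) (f : R -> R) (u v : R) :
  measurable D -> mu.-integrable D (EFin \o f) ->
  (forall x, D x -> 0 <= f x) -> u < v -> `[u, v] `<=` D ->
  (forall x, u <= x <= v -> 0 < f x /\ {for x, continuous f}) ->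
  0 < \int[mu]_(x in D) f x.
Proof.
move=> mD intf f0 uv uvD fuv.
have [|c cuv cmin] := @EVT_min R f u v (ltW uv).
  by apply: continuous_itv_within => x /fuv[].
have [fc0 _] : 0 < f c /\ {for c, continuous f} by apply: fuv; rewrite in_itv /= in cuv.
have : \int[mu]_(x in `[u, v]) f x <= \int[mu]_(x in D) f x.
  rewrite /Rintegral fine_le//.
  - apply: integrable_fin_num => //; exact: integrableS intf.
  - exact: integrable_fin_num.
  - apply: ge0_subset_integral => //.
    by apply: measurable_int intf.
apply: lt_le_trans; apply: (@lt_le_trans _ _ (f c * (v - u))).
  by rewrite mulr_gt0// subr_gt0.
have -> : f c * (v - u) = \int[mu]_(x in `[u, v]) (fun=> f c) x.
  by rewrite Rintegral_cst//= lebesgue_measure_itv /= lte_fin uv.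
apply: le_Rintegral => //.
- by apply: continuous_itv_integrable => x _; exact: cst_continuous.
- exact: integrableS intf.
Qed.

Lemma derive_Lipschitz (f df : R -> R) (C : R) :
  (forall x : R, is_derive x 1 f (df x)) -> (forall x, `|df x| <= C) ->
  forall x y, `|f x - f y| <= C * `|x - y|.
Proof.
move=> fdf dfC.
have cf (z : R) : {for z, continuous f} by exact: is_derive_continuous (fdf z).
move=> x y; wlog yx : x y / y <= x.
  move=> h; have [/h//|/ltW /h] := leP y x.
  by rewrite distrC [`|y - x|]distrC.
have [//||c _ ->] := @MVT_segment R f df y x.
  by apply: continuous_itv_within => ? _; exact: cf.
by rewrite normrM ler_wpM2r.
Qed.

(** Small values of [e] make the linear term dominate; this extracts the
    Euler-Lagrange equation in [first_variation]. *)
Lemma quadratic_ge0_linear0 (L M : R) :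
  (forall e, 0 <= 2 * e * L + e ^+ 2 * M) -> L = 0.
Proof.
move=> h; apply/eqP/negPn/negP => L0.
have L2 : 0 < L ^+ 2 by rewrite exprn_even_gt0.
pose k := `|M| + 1.
have k0 : 0 < k by rewrite /k; have := normr_ge0 M; lra.
have Mk : M < 2 * k by rewrite /k; have := ler_norm M; have := normr_ge0 M; lra.
have := h (- L / k).
have -> : 2 * (- L / k) * L + (- L / k) ^+ 2 * M = - (L ^+ 2 / k ^+ 2 * (2 * k - M)).
  by field; lra.
rewrite oppr_ge0 leNgt => /negP; apply.
by apply: mulr_gt0; [exact: divr_gt0 (exprn_gt0 _ _)|lra].
Qed.

(** The difference quotient at [c] is [k] itself, so continuity of [k] is
    enough. The boundary term of the Poincare inequality has this form at the
    mean, where its factor [k] need not be differentiable. *)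
Lemma is_derive_mul_subr (k : R -> R) (c : R) : {for c, continuous k} ->
  is_derive c 1 (fun x => k x * (x - c)) (k c).
Proof.
move=> kc; apply/is_derive1_caratheodory; exists k; split => // z.
by rewrite subrr mulr0 subr0.
Qed.

(** Completed at [c] by the derivative, which makes it continuous there. *)
Definition secant_slope (f : R -> R) (c x : R) : R :=
  if x == c then derive1 f c else (f x - f c) / (x - c).

Lemma secant_slopeE f c x : f x - f c = secant_slope f c x * (x - c).
Proof.
rewrite /secant_slope; case: eqVneq => [->|xc]; first by rewrite !subrr mulr0.
by rewrite divfK// subr_eq0.
Qed.

Lemma continuous_secant_slope (f : R -> R) (c : R) : derivable f c 1 ->
  {for c, continuous (secant_slope f c)}.
Proof.
move=> df; have : is_derive c 1 f (derive1 f c) by apply: DeriveDef; rewrite ?derive1E.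
move=> /is_derive1_caratheodory[g [fg cg gc]].
suff -> : secant_slope f c = g by [].
apply/funext => x; rewrite /secant_slope; case: eqVneq => [->//|xc].
by rewrite fg mulfK// subr_eq0.
Qed.

Lemma is_derive_secant_slope (f : R -> R) (c x df : R) : x != c -> is_derive x 1 f df ->
  is_derive x 1 (secant_slope f c) ((df - secant_slope f c x) / (x - c)).
Proof.
move=> xc fx; have xc0 : x - c != 0 by rewrite subr_eq0.
apply: (@near_eq_is_derive _ _ _ (fun y => (f y - f c) * (y - c)^-1)).
- near=> y; rewrite /secant_slope; case: eqVneq => // yc.
  have : y != c by near: y; apply: open_nbhs_nbhs; split; [exact: open_neq|exact: xc].
  by rewrite yc eqxx.
- have dV : is_derive x 1 (fun y => (y - c)^-1) (- (x - c) ^- 2 *: 1).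
    by apply: is_deriveV => //; apply: is_derive_eq; rewrite subr0.
  apply: is_derive_eq; rewrite /secant_slope (negbTE xc) /GRing.scale /=.
  by field.
Unshelve. all: by end_near. Qed.

End Line.

(** * Exhausting an open interval *)

Section Interval.
Variables (R : realType) (x1 x2 : \bar R).
Notation mu := (@lebesgue_measure R).
Notation I := (oint x1 x2).

Lemma oint_between (x y z : R) : I x -> I y -> x <= z <= y -> I z.
Proof.
move=> /andP[x1x _] /andP[_ yx2] /andP[xz zy]; apply/andP; split.
- by apply: lt_le_trans x1x _; rewrite lee_fin.
- by apply: le_lt_trans yx2; rewrite lee_fin.
Qed.

(** A presentation of the domains of [integral_from] that treats finite and
    infinite left ends alike, as the fundamental theorem of calculus requires. *)
Lemma integral_from_domain : (x1 < x2)%E -> exists l : itv_bound R,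
  (forall x, I x ->
    [set z : R | (x1 < z%:E <= x%:E)%E] = [set` Interval l (BRight x)]) /\
  (forall x, I x -> (l < BRight x)%E).
Proof.
move=> x12; pose l := if x1 is EFin a then BRight a else BInfty R true.
exists l; split => x; rewrite /l.
- move=> Ix; apply/seteqP; clear l; split => z /=;
    move: x12 Ix; case: x1 => [a||] //= _ /andP[] //;
    by rewrite in_itv /= ?lte_fin ?lee_fin ?ltNyr.
- rewrite /oint /=; clear l.
  by move: x12; case: x1 => [a||] //= _ /andP[].
Qed.

Lemma oint_open : open I.
Proof.
have -> : I = [set x : R | (x1 < x%:E)%E] `&` [set x : R | (x%:E < x2)%E].
  by apply/seteqP; split => x /=; [move/andP | move=> [? ?]; apply/andP].
apply: openI.
- by case: x1 => [a||]; [
    under eq_set do rewrite lte_fin; exact: open_gt |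
    rewrite [X in open X](_ : _ = set0); [exact: open0|
      by apply/seteqP; split=> x //=]|
    rewrite [X in open X](_ : _ = setT); [exact: openT|
      by apply/seteqP; split=> x //= _; rewrite ltNyr]].
- by case: x2 => [a||]; [
    under eq_set do rewrite lte_fin; exact: open_lt |
    rewrite [X in open X](_ : _ = setT); [exact: openT|
      by apply/seteqP; split=> x //= _; rewrite ltry]|
    rewrite [X in open X](_ : _ = set0); [exact: open0|
      by apply/seteqP; split=> x //=]].
Qed.

Lemma oint_nbhs x : I x -> \forall y \near x, I y.
Proof. by move=> Ix; exact: open_nbhs_nbhs (conj oint_open Ix). Qed.

Lemma measurable_oint : measurable I.
Proof. exact: open_measurable oint_open. Qed.

Lemma near_left_end x : I x -> \forall y \near to_left_end x1, I y /\ y < x.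
Proof.
rewrite /to_left_end /oint; case: x1 => [a||] Ix; have /andP[+ _] := Ix => //.
- rewrite lte_fin => ax.
  near=> y; have yx : y < x by near: y; exact: nbhs_right_lt.
  split=> //; have /andP[_ h] := Ix; apply/andP; split.
    by rewrite lte_fin; near: y; exact: nbhs_right_gt.
  by apply: lt_trans h; rewrite lte_fin.
- move=> _; near=> y; have yx : y < x by near: y; apply: nbhs_ninfty_lt; rewrite num_real.
  split=> //; have /andP[_ h] := Ix; apply/andP; split; first exact: ltNyr.
  by apply: lt_trans h; rewrite lte_fin.
Unshelve. all: by end_near. Qed.

Lemma near_right_end x : I x -> \forall y \near to_right_end x2, I y /\ x < y.
Proof.
rewrite /to_right_end /oint; case: x2 => [a||] Ix; have /andP[_ +] := Ix => //.
- rewrite lte_fin => ax.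
  near=> y; have yx : x < y by near: y; exact: nbhs_left_gt.
  split=> //; have /andP[h _] := Ix; apply/andP; split.
    by apply: lt_trans h _; rewrite lte_fin.
  by rewrite lte_fin; near: y; exact: nbhs_left_lt.
- move=> _; near=> y; have yx : x < y by near: y; apply: nbhs_pinfty_gt; rewrite num_real.
  split=> //; have /andP[h _] := Ix; apply/andP; split; last exact: ltry.
  by apply: lt_trans h _; rewrite lte_fin.
Unshelve. all: by end_near. Qed.

#[global] Instance to_left_end_proper : ProperFilter (to_left_end x1).
Proof. by rewrite /to_left_end; case: x1 => [r||]; exact: _. Qed.

#[global] Instance to_right_end_proper : ProperFilter (to_right_end x2).
Proof. by rewrite /to_right_end; case: x2 => [r||]; exact: _. Qed.

(** Monotonicity is strict so that a ramp of a clamp fits between consecutive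
    terms. *)
Definition exhausts (a b : nat -> R) :=
  [/\ (forall n, I (a n) /\ I (b n)), (forall n, a n.+1 < a n /\ b n < b n.+1),
      (forall n, a n < b n),
      a @ \oo --> to_left_end x1 & b @ \oo --> to_right_end x2].

Lemma exhaustion_left c : I c -> exists a : nat -> R, [/\ forall n, I (a n),
  forall n, a n.+1 < a n, forall n, a n < c & a @ \oo --> to_left_end x1].
Proof.
move=> Ic; have /andP[x1c cx2] := Ic.
have Iac (y : R) : (x1 < y%:E)%E -> y < c -> I y.
  by move=> x1y yc; apply/andP; split => //; apply: lt_trans cx2; rewrite lte_fin.
rewrite /to_left_end; move: x1 x1c Iac {Ic} => [r|//|] /= x1c Iac.
- rewrite lte_fin in x1c.
  (* the index n + 2 keeps every term strictly below c *)
  pose a n := r + (c - r) * (n.+2%:R)^-1.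
  have cr : 0 < c - r by lra.
  have ra n : r < a n by rewrite ltrDl divr_gt0.
  have ac n : a n < c.
    rewrite -ltrBrDl -[ltRHS]mulr1 ltr_pM2l// invf_lt1// ltr1n //.
  exists a; split=> //.
  + by move=> n; apply: Iac; rewrite ?lte_fin.
  + by move=> n; rewrite ltrD2l ltr_pM2l// ltf_pV2 ?posrE// ltr_nat.
  + have ar : a @ \oo --> r.
      rewrite -[X in _ --> X]addr0 -(mulr0 (c - r)).
      apply: cvgD; first exact: cvg_cst.
      apply: cvgM; first exact: cvg_cst.
      by have := @cvg_harmonic R; rewrite -(cvg_shiftn 1); under eq_fun do rewrite /= addn1.
    move=> A hA; have : \forall n \near \oo, r < a n -> A (a n) := ar _ hA.
    by apply: filterS => n; apply; exact: ra.
- exists (fun n => c - n.+1%:R); split.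
  + by move=> n; apply: Iac; rewrite ?ltNyr// ltrBlDr ltrDl.
  + by move=> n; rewrite ltrD2l ltrN2 ltr_nat.
  + by move=> n;  rewrite ltrBlDr ltrDl.
  + apply/cvgrNyPle => A; near=> n.
    have : c - A <= n%:R by near: n; exact: nbhs_infty_ger.
    by rewrite -[n.+1%:R]natr1; lra.
Unshelve. all: by end_near. Qed.

Lemma exhaustion_right c : I c -> exists b : nat -> R, [/\ forall n, I (b n),
  forall n, b n < b n.+1, forall n, c < b n & b @ \oo --> to_right_end x2].
Proof.
move=> Ic; have /andP[cx1 x2c] := Ic.
have Iac (y : R) : (y%:E < x2)%E -> c < y -> I y.
  by move=> x1y yc; apply/andP; split => //; apply: lt_trans cx1 _; rewrite lte_fin.
rewrite /to_right_end; move: x2 x2c Iac {Ic} => [r| |//] /= x2c Iac.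
- rewrite lte_fin in x2c.
  pose a n := r - (r - c) * (n.+2%:R)^-1.
  have cr : 0 < r - c by lra.
  have ra n : a n < r by rewrite gtrBl divr_gt0.
  have ac n : c < a n.
    rewrite ltrBrDr -ltrBrDl -[ltRHS]mulr1 ltr_pM2l// invf_lt1// ltr1n //.
  exists a; split=> //.
  + by move=> n; apply: Iac; rewrite ?lte_fin.
  + by move=> n; rewrite ltrD2l ltrN2 ltr_pM2l// ltf_pV2 ?posrE// ltr_nat.
  + have ar : a @ \oo --> r.
      rewrite -[X in _ --> X]subr0 -(mulr0 (r - c)).
      apply: cvgB; first exact: cvg_cst.
      apply: cvgM; first exact: cvg_cst.
      by have := @cvg_harmonic R; rewrite -(cvg_shiftn 1); under eq_fun do rewrite /= addn1.
    move=> A hA; have : \forall n \near \oo, a n < r -> A (a n) := ar _ hA.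
    by apply: filterS => n; apply; exact: ra.
- exists (fun n => c + n.+1%:R); split.
  + by move=> n; apply: Iac; rewrite ?ltry// ltrDl.
  + by move=> n; rewrite ltrD2l ltr_nat.
  + by move=> n; rewrite ltrDl.
  + apply/cvgryPge => A; near=> n.
    have : A - c <= n%:R by near: n; exact: nbhs_infty_ger.
    by rewrite -[n.+1%:R]natr1; lra.
Unshelve. all: by end_near. Qed.

Lemma exhaustion c : I c -> exists a b : nat -> R, [/\ exhausts a b,
  forall n, a n < c & forall n, c < b n].
Proof.
move=> Ic; have [a [Ia da ac al]] := exhaustion_left Ic.
have [b [Ib ib cb br]] := exhaustion_right Ic.
exists a, b; split => //; split => //.
by move=> n; apply: lt_trans (ac n) (cb n).
Qed.

Section along_exhaustion.
Variables a b : nat -> R.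
Hypothesis ab : exhausts a b.

Lemma exhausts_mem n x : a n <= x <= b n -> I x.
Proof. by case: ab => Iab _ _ _ _; have [Ia Ib] := Iab n; exact: oint_between. Qed.

Lemma exhausts_near x : I x -> \forall n \near \oo, a n < x /\ x < b n.
Proof.
case: ab => _ _ _ al br Ix.
have al' : \forall n \near \oo, I (a n) /\ a n < x := al _ (near_left_end Ix).
have br' : \forall n \near \oo, I (b n) /\ x < b n := br _ (near_right_end Ix).
by apply: filterS2 al' br' => n [_ ?] [_ ?].
Qed.

Lemma exhausts_nondecreasing m n : (m <= n)%N -> a n <= a m /\ b m <= b n.
Proof.
case: ab => _ mono _ _ _; move=> /subnKC <-; elim: (n - m)%N => [|k [ih1 ih2]].
  by rewrite addn0.
rewrite addnS; have [h1 h2] := mono (m + k)%N.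
by split; [exact: le_trans (ltW h1) ih1|exact: le_trans ih2 (ltW h2)].
Qed.

Lemma ge0_integral_exhausts (f : R -> \bar R) : measurable_fun I f ->
  (forall x, I x -> 0 <= f x)%E ->
  (\int[mu]_(x in `[a n, b n]) f x @[n --> \oo] --> \int[mu]_(x in I) f x)%E.
Proof.
move=> mf f0; apply: ge0_integral_cvg_sets => //.
- exact: measurable_oint.
- move=> m n /exhausts_nondecreasing [h1 h2]; apply/subsetPset => x /=.
  by rewrite !in_itv /= => /andP[ax xb]; rewrite (le_trans h1)//= (le_trans xb).
- by move=> n x /=; rewrite in_itv /=; exact: exhausts_mem.
- move=> x /exhausts_near[n _ ndef]; exists n.
  by have [ax xb] := ndef n (leqnn n); rewrite /= in_itv /= !ltW.
Qed.

End along_exhaustion.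

End Interval.

(** * A continuously differentiable clamp *)

Section Clamp.
Variable R : realType.

Lemma is_derive_mulr_normr (x : R) : is_derive x 1 (fun y : R => y * `|y|) (2 * `|x|).
Proof.
have [x0|x0|->] := ltgtP x 0.
- apply: (@near_eq_is_derive _ _ _ (fun y : R => - (y ^+ 2))) => //.
  + near=> y; rewrite ltr0_norm ?expr2 ?mulrN //; near: y; exact: lt_nbhsl.
  + by apply: is_derive_eq; rewrite ltr0_norm// /GRing.scale /=; ring.
- apply: (@near_eq_is_derive _ _ _ (fun y : R => (y ^+ 2))) => //.
  + near=> y; rewrite gtr0_norm ?expr2 //; near: y; exact: lt_nbhsr.
  + by apply: is_derive_eq; rewrite gtr0_norm// /GRing.scale /=; ring.
- rewrite normr0 mulr0.
  suff h : h^-1 *: (((fun y : R => y * `|y|) \o shift 0) (h *: 1) - 0 * `|0 : R|) @[h --> 0^'] --> (0:R).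
    by apply: DeriveDef; [apply/cvg_ex; exists 0 | exact: cvg_lim h].
  apply: (@cvg_trans _ ((fun h : R => `|h|) @ 0^')); last first.
    apply: cvg_within_filter.
    by have := @norm_continuous R R 0; rewrite /continuous_at normr0.
  apply: near_eq_cvg; near=> h.
  have h0 : h != 0 by near: h; exact: nbhs_dnbhs_neq.
  by rewrite /GRing.scale /= mulr1 addr0 mul0r subr0 mulrA mulVf// mul1r.
Unshelve. all: by end_near. Qed.

(** Centered, so that it rises from -1/2 to 1/2: as a difference of absolute
    values it has an elementary primitive on the whole line. *)
Definition ramp (a b x : R) : R := (`|x - a| - `|x - b|) / (2 * (b - a)).

Definition ramp_primitive (a b x : R) : R :=
  ((x - a) * `|x - a| - (x - b) * `|x - b|) / (4 * (b - a)).

Lemma is_derive_ramp_primitive a b (x : R) : a < b ->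
  is_derive x 1 (ramp_primitive a b) (ramp a b x).
Proof.
move=> ab.
have h c : is_derive x 1 (fun y : R => (y - c) * `|y - c|) (2 * `|x - c|).
  have := @is_derive1_comp R (fun y : R => y * `|y|) (fun y => y - c) x (2 * `|x - c|) 1.
  rewrite mulr1; apply.
    exact: is_derive_mulr_normr.
  by apply: is_derive_eq; rewrite subr0.
rewrite /ramp_primitive /ramp.
have -> : (`|x - a| - `|x - b|) / (2 * (b - a)) =
  (4 * (b - a))^-1 *: (2 * `|x - a| - 2 * `|x - b|).
  by rewrite /GRing.scale /=; field; lra.
rewrite (_ : (fun x : R => _) = (4 * (b - a))^-1 \*: ((fun y : R => (y - a) * `|y - a|) - (fun y : R => (y - b) * `|y - b|))).
  exact: is_deriveZ.
by apply/funext => y /=; rewrite mulrC.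
Qed.

Lemma continuous_ramp a b : continuous (ramp a b).
Proof.
move=> x; rewrite /ramp; apply: cvgM; last exact: cvg_cst.
by apply: cvgB; apply: cvg_norm; apply: cvgB => //; exact: cvg_cst.
Qed.

Lemma ramp_le a b x : a < b -> x <= a -> ramp a b x = - 2^-1.
Proof.
move=> ab xa; rewrite /ramp !ler0_norm; try lra.
by field; lra.
Qed.

Lemma ramp_ge a b x : a < b -> b <= x -> ramp a b x = 2^-1.
Proof.
move=> ab xa; rewrite /ramp !ger0_norm; try lra.
by field; lra.
Qed.

Lemma ramp_bounds a b x : a < b -> - 2^-1 <= ramp a b x <= 2^-1.
Proof.
move=> ab; have ab0 : 0 < b - a by lra.
rewrite /ramp ler_pdivrMr ?ler_pdivlMr ?mulr_gt0 //; try lra.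
have : `|x - a| - `|x - b| <= `|(x - a) - (x - b)| by exact: lerB_dist.
have : `|x - b| - `|x - a| <= `|(x - b) - (x - a)| by exact: lerB_dist.
have -> : x - a - (x - b) = b - a by ring.
have -> : x - b - (x - a) = - (b - a) by ring.
by rewrite normrN (gtr0_norm ab0) => *; apply/andP; split; lra.
Qed.

Lemma ramp_primitive_le a b x : a < b -> x <= a ->
  ramp_primitive a b x = (a + b) / 4 - x / 2.
Proof.
move=> ab xa; rewrite /ramp_primitive !ler0_norm; try lra.
by field; lra.
Qed.

Lemma ramp_primitive_ge a b x : a < b -> b <= x ->
  ramp_primitive a b x = x / 2 - (a + b) / 4.
Proof.
move=> ab xa; rewrite /ramp_primitive !ger0_norm; try lra.
by field; lra.
Qed.

Definition trapezoid (a a' b' b x : R) : R := ramp a a' x - ramp b' b x.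

(** The additive constant makes the clamp the identity on [[a', b']]. *)
Definition clamp (a a' b' b x : R) : R :=
  ramp_primitive a a' x - ramp_primitive b' b x + (a + a' + b' + b) / 4.

Section clamp_theory.
Variables a a' b' b : R.
Local Notation clamp_nodes := [/\ a < a', a' <= b' & b' < b].

Local Notation T := (clamp a a' b' b).
Local Notation h := (trapezoid a a' b' b).

Lemma is_derive_clamp (x : R) : clamp_nodes -> is_derive x 1 T (h x).
Proof. move=> [aa' ab' bb'].
rewrite /clamp; have -> : h x = h x + 0 by rewrite addr0.
apply: is_deriveD; apply: is_deriveB; exact: is_derive_ramp_primitive.
Qed.

Lemma continuous_trapezoid : continuous h.
Proof. by move=> x; apply: cvgB; exact: continuous_ramp. Qed.

Lemma trapezoid_bounds (x : R) : clamp_nodes -> 0 <= h x <= 1.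
Proof. move=> [aa' ab' bb'].
rewrite /trapezoid.
have /andP[h1 h2] := ramp_bounds x aa'; have /andP[h3 h4] := ramp_bounds x bb'.
have [xb|bx] := leP x b'.
  by rewrite [ramp b' b x]ramp_le//; lra.
by rewrite [ramp a a' x]ramp_ge//; lra.
Qed.

Lemma trapezoid_out (x : R) : clamp_nodes -> x <= a \/ b <= x -> h x = 0.
Proof. move=> [aa' ab' bb'].
rewrite /trapezoid; case=> h; first by rewrite !ramp_le//; lra.
by rewrite !ramp_ge//; lra.
Qed.

Lemma trapezoid_in (x : R) : clamp_nodes -> a' <= x <= b' -> h x = 1.
Proof. move=> [aa' ab' bb'].
by move=> /andP[h1 h2]; rewrite /trapezoid ramp_ge// ramp_le//; lra.
Qed.

Lemma clamp_in (x : R) : clamp_nodes -> a' <= x <= b' -> T x = x.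
Proof. move=> [aa' ab' bb'].
move=> /andP[h1 h2]; rewrite /clamp ramp_primitive_ge// ramp_primitive_le//; lra.
Qed.

Lemma clamp_contraction (x y : R) : clamp_nodes -> `|T x - T y| <= `|x - y|.
Proof. move=> [aa' ab' bb'].
have dT z := is_derive_clamp z (And3 aa' ab' bb').
rewrite -[leRHS]mul1r; apply: (@derive_Lipschitz R T h 1 dT).
by move=> z; have /andP[h1 h2] := trapezoid_bounds z (And3 aa' ab' bb'); rewrite ger0_norm.
Qed.

Lemma clamp_nondecreasing (x y : R) : clamp_nodes -> x <= y -> T x <= T y.
Proof. move=> [aa' ab' bb'].
move=> xy.
have [//|z _||c _ E] := @MVT_segment R T h x y.
- exact: is_derive_clamp.
- apply: continuous_itv_within => z _; apply: differentiable_continuous.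
  by apply/derivable1_diffP; case: (is_derive_clamp z (And3 aa' ab' bb')).
- rewrite -subr_ge0 E; apply: mulr_ge0; last by rewrite subr_ge0.
  by have /andP[] := trapezoid_bounds c (And3 aa' ab' bb').
Qed.

Lemma clamp_bounds (x : R) : clamp_nodes -> (a + a') / 2 <= T x <= (b' + b) / 2.
Proof. move=> [aa' ab' bb'].
have Ta : T (Num.min a x) = (a + a') / 2.
  rewrite /clamp !ramp_primitive_le ?ge_min ?lexx//; first lra.
  by apply/orP; left; lra.
have Tb : T (Num.max b x) = (b' + b) / 2.
  rewrite /clamp !ramp_primitive_ge ?le_max ?lexx//; first lra.
  by apply/orP; left; lra.
rewrite -Ta -Tb; apply/andP; split; apply: clamp_nondecreasing => //.
  by rewrite ge_min lexx orbT.
by rewrite le_max lexx orbT.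
Qed.

End clamp_theory.
End Clamp.

(** * Integrals against the density *)

Section growth.
Variable R : realType.

(** A finite second moment makes the product of two such functions integrable
    against the density. *)
Definition linear_growth (f : R -> R) := exists2 A, 0 <= A & forall x, `|f x| <= A * (1 + `|x|).

Lemma linear_growth_Lipschitz f C : (forall x y, `|f x - f y| <= C * `|x - y|) -> linear_growth f.
Proof.
move=> h; exists (`|f 0| + `|C|) => // x.
have := h x 0; rewrite subr0 => h1.
have : `|f x| <= `|f x - f 0| + `|f 0| by rewrite -{1}(subrK (f 0) (f x)); exact: ler_normD.
have : C * `|x| <= `|C| * `|x| by rewrite ler_wpM2r// ler_norm.
have : 0 <= `|f 0| * `|x| by [].
have : 0 <= `|C| by [].
rewrite mulrDr mulr1 mulrDl; lra.
Qed.

Lemma linear_growth_cst c : linear_growth (fun=> c).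
Proof. by apply: (@linear_growth_Lipschitz _ 0) => x y; rewrite subrr normr0 mul0r. Qed.

Lemma linear_growth_id : linear_growth id.
Proof. by apply: (@linear_growth_Lipschitz _ 1) => x y; rewrite mul1r. Qed.

Lemma linear_growthD f g : linear_growth f -> linear_growth g -> linear_growth (fun x => f x + g x).
Proof.
move=> [A A0 hA] [B B0 hB]; exists (A + B); first exact: addr_ge0.
by move=> x; rewrite mulrDl (le_trans (ler_normD _ _))// lerD.
Qed.

Lemma linear_growthZ c f : linear_growth f -> linear_growth (fun x => c * f x).
Proof.
move=> [A A0 hA]; exists (`|c| * A); first exact: mulr_ge0.
by move=> x; rewrite normrM -mulrA ler_wpM2l.
Qed.

End growth.

Section Density.
Variables (R : realType) (x1 x2 : \bar R) (p : R -> R).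
Hypotheses (hx : (x1 < x2)%E) (hp : stationary_density x1 x2 p).
Notation mu := (@lebesgue_measure R).
Notation I := (oint x1 x2).

Lemma density_gt0 x : I x -> 0 < p x.
Proof. by case: hp => _ + _ _; apply. Qed.

Lemma density_continuous x : I x -> {for x, continuous p}.
Proof. by case: hp => + _ _ _; apply. Qed.

Lemma continuous_on_measurable f : continuous_on I f -> measurable_fun I f.
Proof.
move=> cf; apply: open_continuous_measurable_fun; first exact: oint_open.
by move=> x; rewrite inE; exact: cf.
Qed.

Lemma density_integrable : mu.-integrable I (EFin \o p).
Proof.
apply/integrableP; split.
  by apply/measurable_EFinP; apply: continuous_on_measurable => x; exact: density_continuous.
under eq_integral => x.
  rewrite inE => Ix; rewrite /= ger0_norm ?ltW ?density_gt0//; over.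
by case: hp => _ _ -> _; exact: ltry.
Qed.

Lemma second_moment_integrable : mu.-integrable I (EFin \o (fun x => x ^+ 2 * p x)).
Proof.
apply/integrableP; split.
  apply/measurable_EFinP; apply: continuous_on_measurable => x Ix.
  by apply: continuousM; [exact: exprn_continuous|exact: density_continuous].
under eq_integral => x.
  rewrite inE => Ix; rewrite /= ger0_norm; last by rewrite mulr_ge0 ?sqr_ge0 ?ltW ?density_gt0.
  over.
by case: hp.
Qed.

Lemma density_integrableM f g : continuous_on I f -> continuous_on I g ->
  linear_growth f -> linear_growth g ->
  mu.-integrable I (EFin \o (fun x => p x * (f x * g x))).
Proof.
move=> cf cg [A A0 hA] [B B0 hB].
have i1 : mu.-integrable I (EFin \o (fun x => 2 * A * B * (p x + x ^+ 2 * p x))).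
  apply: integrable_scale; first exact: measurable_oint.
  apply: integrable_add; first exact: measurable_oint.
    exact: density_integrable.
  exact: second_moment_integrable.
apply: le_integrable i1; first exact: measurable_oint.
  apply/measurable_EFinP; apply: continuous_on_measurable => x Ix.
  by apply: continuousM; [exact: density_continuous|apply: continuousM; [exact: cf|exact: cg]].
move=> x Ix /=; rewrite lee_fin.
have p0 := density_gt0 Ix.
rewrite normrM gtr0_norm// [leRHS]ger0_norm; last first.
  apply: mulr_ge0; first by rewrite !mulr_ge0.
  by apply: addr_ge0; [exact: ltW|rewrite mulr_ge0 ?sqr_ge0// ltW].
apply: (@le_trans _ _ (p x * (A * (1 + `|x|) * (B * (1 + `|x|))))).
  by rewrite ler_wpM2l; [|exact: ltW|rewrite normrM; exact: ler_pM].
have -> : 2 * A * B * (p x + x ^+ 2 * p x) = p x * (A * B * (2 * (1 + `|x| ^+ 2))).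
  by rewrite real_normK ?num_real//; ring.
apply: ler_wpM2l; first exact: ltW.
have -> : A * (1 + `|x|) * (B * (1 + `|x|)) = A * B * (1 + `|x|) ^+ 2 by ring.
apply: ler_wpM2l; first exact: mulr_ge0.
have := sqr_ge0 (1 - `|x|); nra.
Qed.

Lemma density_integrable1 f : continuous_on I f -> linear_growth f ->
  mu.-integrable I (EFin \o (fun x => p x * f x)).
Proof.
move=> cf gf; have := @density_integrableM f (fun=> 1) cf.
under [X in _ -> _ -> _ -> integrable _ _ (EFin \o X)]eq_fun do rewrite mulr1.
apply => //; first by move=> x _; exact: cst_continuous.
exact: linear_growth_cst.
Qed.

Lemma square_integrable_integrable f : continuous_on I f ->
  mu.-integrable I (EFin \o (fun x => p x * f x ^+ 2)) ->
  mu.-integrable I (EFin \o (fun x => p x * f x)).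
Proof.
move=> cf f2; have mI := @measurable_oint R x1 x2.
apply: (@le_integrable _ _ _ mu I mI _ (EFin \o (fun x => p x + p x * f x ^+ 2))).
- apply/measurable_EFinP; apply: continuous_on_measurable => x Ix.
  by apply: continuousM; [exact: density_continuous|exact: cf].
- move=> x Ix /=; have p0 := density_gt0 Ix.
  rewrite lee_fin normrM (gtr0_norm p0) [leRHS]ger0_norm; last first.
    by apply: addr_ge0; [exact: ltW|apply: mulr_ge0; [exact: ltW|exact: sqr_ge0]].
  rewrite -[X in X + _]mulr1 -mulrDr; apply: ler_wpM2l; first exact: ltW.
  rewrite -[f x ^+ 2]real_normK ?num_real//.
  have := normr_ge0 (f x); have := sqr_ge0 (1 - `|f x|); nra.
- by apply: integrable_add => //; exact: density_integrable.
Qed.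

Lemma expectation_lin a b f g :
  mu.-integrable I (EFin \o (fun x => p x * f x)) ->
  mu.-integrable I (EFin \o (fun x => p x * g x)) ->
  \int[mu]_(x in I) (p x * (a * f x + b * g x)) =
  a * \int[mu]_(x in I) (p x * f x) + b * \int[mu]_(x in I) (p x * g x).
Proof.
move=> fi gi.
under eq_Rintegral do rewrite mulrDr !(mulrCA (p _)).
have mI := @measurable_oint R x1 x2.
rewrite RintegralD//.
- by rewrite !RintegralZl.
- exact: integrable_scale.
- exact: integrable_scale.
Qed.

Lemma expectation_lin_integrable a b f g :
  mu.-integrable I (EFin \o (fun x => p x * f x)) ->
  mu.-integrable I (EFin \o (fun x => p x * g x)) ->
  mu.-integrable I (EFin \o (fun x => p x * (a * f x + b * g x))).
Proof.
move=> fi gi.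
have -> : (fun x => p x * (a * f x + b * g x)) = (fun x => a * (p x * f x) + b * (p x * g x)).
  by apply/funext => x; ring.
have mI := @measurable_oint R x1 x2.
by apply: integrable_add => //; exact: integrable_scale.
Qed.

Lemma expectation1 : \int[mu]_(x in I) p x = 1.
Proof. by case: hp => _ _ h _; rewrite /Rintegral h. Qed.

Lemma expectation_cst c : \int[mu]_(x in I) (p x * c) = c.
Proof.
rewrite RintegralZr ?expectation1 ?mul1r//; first exact: measurable_oint.
exact: density_integrable.
Qed.

Notation m1 := (moment x1 x2 p 1).
Notation m2 := (moment x1 x2 p 2).

Lemma moment1E : m1 = \int[mu]_(x in I) (p x * x).
Proof. by rewrite /moment; apply: eq_Rintegral => x _; rewrite expr1 mulrC. Qed.

Lemma moment2E : m2 = \int[mu]_(x in I) (p x * (x * x)).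
Proof. by rewrite /moment; apply: eq_Rintegral => x _; rewrite expr2 mulrC. Qed.

Lemma continuous_on_id : continuous_on I id.
Proof. by move=> x _; exact: cvg_id. Qed.

Lemma continuous_on_cst (c : R) : continuous_on I (fun=> c).
Proof. by move=> x _; exact: cvg_cst. Qed.

#[local] Hint Resolve continuous_on_id continuous_on_cst linear_growth_id linear_growth_cst : core.

Lemma oint_ex : exists u v : R, [/\ I u, I v & u < v].
Proof.
have [m hm] : exists m, I m.
  move: hx; rewrite /oint; case: x1 => [a||]; case: x2 => [b||] //= h.
  - by exists ((a + b) / 2); rewrite !lte_fin in h *; apply/andP; split; lra.
  - by exists (a + 1); rewrite lte_fin ltry andbT; lra.
  - by exists (b - 1); rewrite lte_fin ltNyr /=; lra.
  - by exists 0; rewrite ltNyr ltry.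
have [b [Ib _ mb _]] := exhaustion_right hm.
by exists m, (b 0%N); split.
Qed.

Lemma expectation_gt0 f : continuous_on I f ->
  mu.-integrable I (EFin \o (fun x => p x * f x)) ->
  (forall x, I x -> 0 < f x) -> 0 < \int[mu]_(x in I) (p x * f x).
Proof.
move=> cf fi f0; have [u [v [Iu Iv uv]]] := oint_ex.
have sub x : u <= x <= v -> I x by exact: oint_between.
apply: (@Rintegral_gt0 R I _ u v) => //.
- exact: measurable_oint.
- by move=> x Ix; rewrite mulr_ge0 ?ltW ?density_gt0 ?f0.
- move=> x /sub Ix; split; first by rewrite mulr_gt0 ?density_gt0 ?f0.
  by apply: continuousM; [exact: density_continuous|exact: cf].
Qed.

Lemma expectation_centered : \int[mu]_(x in I) (p x * (x - m1)) = 0.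
Proof.
have := @expectation_lin 1 (- m1) id (fun=> 1).
under eq_Rintegral do rewrite mulr1 mul1r.
rewrite -moment1E expectation_cst mulr1 mul1r subrr; apply.
  exact: density_integrable1.
exact: density_integrable1.
Qed.

(** Otherwise [x - m1] would have a constant sign on the interval, although its
    mean is zero. *)
Lemma mean_in : I m1.
Proof.
have cm : continuous_on I (fun x => x - m1) by move=> x Ix; apply: continuousB => //; exact: continuous_on_cst.
have gm : linear_growth (fun x : R => x - m1) by exact: linear_growthD.
have im := density_integrable1 cm gm.
apply/andP; split; rewrite ltNge; apply/negP => h.
- suff : 0 < \int[mu]_(x in I) (p x * (x - m1)) by rewrite expectation_centered ltxx.
  apply: expectation_gt0 => // x /andP[x1x _].
  by rewrite subr_gt0 -lte_fin; apply: le_lt_trans h x1x.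
- suff : 0 < \int[mu]_(x in I) (p x * (m1 - x)).
    under eq_Rintegral do rewrite -opprB mulrN -mulN1r.
    rewrite RintegralZl ?expectation_centered ?mulr0 ?ltxx//.
    exact: measurable_oint.
  have cm' : continuous_on I (fun x => m1 - x) by move=> x Ix; apply: continuousB => //; exact: continuous_on_cst.
  apply: expectation_gt0 => //.
    apply: density_integrable1 => //.
    apply: linear_growthD => //; have := linear_growthZ (-1) (@linear_growth_id R).
    by under eq_fun do rewrite mulN1r.
  move=> x /andP[_ xx2]; rewrite subr_gt0 -lte_fin.
  exact: lt_le_trans xx2 h.
Qed.

End Density.

(** * Test functions with bounded derivative and the first variation *)

(** Detailed balance, the flux and the Rayleigh quotient depend on [sigma] only
    through this coefficient. *)
Definition conductance {R : realType} (p : R -> R) (d : diffusion R) (x : R) : R :=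
  2^-1 * sigma d x ^+ 2 * p x.

Definition rayleigh_lower_bound {R : realType} (x1 x2 : \bar R) (p : R -> R)
    (d : diffusion R) (l : R) :=
  forall Q, rayleigh_competitor x1 x2 p d Q -> (l%:E <= rayleigh x1 x2 p d Q)%E.

Section Rayleigh.
Variables (R : realType) (x1 x2 : \bar R) (p : R -> R).
Hypotheses (hx : (x1 < x2)%E) (hp : stationary_density x1 x2 p).
Notation mu := (@lebesgue_measure R).
Notation I := (oint x1 x2).
Notation m1 := (moment x1 x2 p 1).
Let mI : measurable I := @measurable_oint R x1 x2.

Definition expectation (f : R -> R) : R := \int[mu]_(x in I) (p x * f x).
Notation E := expectation.

Definition variance_of (f : R -> R) : R := E (fun x => f x * f x) - E f ^+ 2.

Lemma expectation_sqr_sub f c :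
  mu.-integrable I (EFin \o (fun x => p x * (f x * f x))) ->
  mu.-integrable I (EFin \o (fun x => p x * f x)) ->
  E (fun x => (f x - c) ^+ 2) = E (fun x => f x * f x) - 2 * c * E f + c ^+ 2.
Proof.
move=> i2 i1.
have i0 : mu.-integrable I (EFin \o (fun x => p x * 1)).
  by under eq_fun do rewrite mulr1; exact: density_integrable.
transitivity (E (fun x => 1 * (f x * f x) + 1 * ((- (2 * c)) * f x + c ^+ 2 * 1))).
  by apply: eq_Rintegral => x _; congr (_ * _); ring.
rewrite /E expectation_lin//; last first.
  under eq_fun do rewrite mulrDr mulrCA [p _ * (_ * 1)]mulrCA.
  by apply: integrable_add => //; exact: integrable_scale.
rewrite expectation_lin// mul1r mul1r.
under [X in c ^+ 2 * X]eq_Rintegral do rewrite mulr1.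
by rewrite (expectation1 hp); ring.
Qed.

Lemma variance_ofE f : continuous_on I f -> linear_growth f ->
  variance_of f = E (fun x => (f x - E f) ^+ 2).
Proof.
move=> cf gf; rewrite expectation_sqr_sub; first by rewrite /variance_of; ring.
  exact: density_integrableM.
exact: density_integrable1.
Qed.

Lemma expectation_ge0 f : (forall x, I x -> 0 <= f x) -> 0 <= E f.
Proof.
by move=> f0; apply: Rintegral_ge0 => x Ix; apply: mulr_ge0; [exact: ltW (density_gt0 hp Ix)|exact: f0].
Qed.

Section one_diffusion.
Variables (d : diffusion R) (l : R).
Notation a := (conductance p d).
Hypotheses (ai : mu.-integrable I (EFin \o a)) (a0 : forall x, I x -> 0 <= a x).
Hypothesis LB : rayleigh_lower_bound x1 x2 p d l.

Section one_function.
Variables (Q dQ : R -> R) (C : R).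
Hypotheses (QdQ : forall x : R, is_derive x 1 Q (dQ x)) (cdQ : continuous dQ)
  (dQC : forall x, `|dQ x| <= C).

Lemma bounded_derive_growth : linear_growth Q.
Proof. by apply: (@linear_growth_Lipschitz _ _ C); apply: derive_Lipschitz dQC. Qed.

Let cQ : continuous_on I Q.
Proof. by move=> x _; exact: is_derive_continuous (QdQ x). Qed.

(** Centering and normalizing [Q] gives a competitor: its flux vanishes near the
    ends because its derivative does. If the variance is zero, the right-hand
    side is nonnegative anyway. *)
Lemma rayleigh_variance_compact (s t : R) : I s -> I t ->
  (forall x, x <= s \/ t <= x -> dQ x = 0) ->
  l * variance_of Q <= \int[mu]_(x in I) (a x * dQ x ^+ 2).
Proof.
move=> Is It dQ0.
have gQ := bounded_derive_growth.
pose m := E Q; pose v := variance_of Q.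
have v0 : 0 <= v.
  by rewrite /v variance_ofE//; apply: expectation_ge0 => x _; exact: sqr_ge0.
move: (v0); rewrite le_eqVlt => /predU1P[v_eq0|vgt0].
  by rewrite -/v -v_eq0 mulr0; apply: Rintegral_ge0 => x Ix; rewrite mulr_ge0 ?a0 ?sqr_ge0.
have sv0 : 0 < Num.sqrt v by rewrite sqrtr_gt0.
have svv : Num.sqrt v ^+ 2 = v by rewrite sqr_sqrtr.
pose Q' x := (Num.sqrt v)^-1 * (Q x - m).
have dQ' (x : R) : is_derive x 1 Q' ((Num.sqrt v)^-1 * dQ x).
  by apply: is_derive_eq; rewrite subr0.
have dQ'E : derive1 Q' = fun x => (Num.sqrt v)^-1 * dQ x.
  by apply/funext => x; rewrite derive1E derive_val.
have cQ' : continuous_on I Q' by move=> x _; exact: is_derive_continuous (dQ' x).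
have gQ' : linear_growth Q' by apply: linear_growthZ; apply: linear_growthD => //; exact: linear_growth_cst.
have flux0 y : dQ y = 0 -> flux p d Q' y = 0.
  by move=> h; rewrite /flux dQ'E h !mulr0.
have dQb : mu.-integrable I (EFin \o (fun x => a x * dQ x ^+ 2)).
  apply: (@integrable_mul_bounded _ _ _ _ (C ^+ 2)) => //.
    by apply: continuous_on_measurable => x _; apply: continuous_sqr; exact: cdQ.
  move=> x _; rewrite normrX lerXn2r ?nnegrE//; exact: le_trans (dQC x).
have /LB : rayleigh_competitor x1 x2 p d Q'.
  split.
  - split; first by move=> x _; have [] := dQ' x.
    rewrite dQ'E => x _; apply: continuousM; [exact: cvg_cst|exact: cdQ].
  - rewrite /normalized integral_EFin_Rintegral//; last first.
      by under eq_fun do rewrite expr2; exact: density_integrableM.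
    congr EFin; transitivity (v^-1 * E (fun x => (Q x - m) ^+ 2)).
      rewrite /E -RintegralZl//; last first.
        under eq_fun do rewrite expr2.
        have cc : continuous_on I (fun x => Q x - m).
          by move=> x Ix; apply: continuousB; [exact: cQ|exact: cvg_cst].
        have gg : linear_growth (fun x => Q x - m).
          by apply: linear_growthD => //; exact: linear_growth_cst.
        exact: density_integrableM.
      apply: eq_Rintegral => x _.
      by rewrite /Q' exprMn exprVn svv mulrCA.
    by rewrite -variance_ofE// mulVf// gt_eqF.
  - rewrite integral_EFin_Rintegral//; last exact: density_integrable1.
    congr EFin; rewrite /Q'.
    transitivity (\int[mu]_(x in I) (p x * ((Num.sqrt v)^-1 * Q x + (- (Num.sqrt v)^-1 * m) * 1))).
      by apply: eq_Rintegral => x _; congr (_ * _); ring.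
    rewrite expectation_lin//; last 2 first.
      exact: density_integrable1.
      by apply: density_integrable1 => //; [move=> x _; exact: cvg_cst|exact: linear_growth_cst].
    by rewrite (expectation_cst hp) -/(E Q) -/m; ring.
  - split; apply: cvg_near_cst.
      have := near_left_end Is; apply: filterS => y [_ ys]; apply: flux0.
      by apply: dQ0; left; exact: ltW.
    have := near_right_end It; apply: filterS => y [_ ys]; apply: flux0.
    by apply: dQ0; right; exact: ltW.
rewrite /rayleigh dQ'E.
under eq_integral do rewrite exprMn exprVn svv -/(conductance p d _) mulrCA.
rewrite integral_EFin_Rintegral//; last exact: integrable_scale.
by rewrite RintegralZl// lee_fin mulrC ler_pdivlMr.
Qed.

End one_function.

(** The flux of [Q] need not vanish at the ends, so [Q] is composed with clamps
    of the identity along an exhaustion of the interval. The compositions have a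
    compactly supported derivative, are dominated by one function of linear
    growth, and at each point agree with [Q] from some index on. *)
Lemma rayleigh_variance (Q dQ : R -> R) (C : R) :
  (forall x : R, is_derive x 1 Q (dQ x)) -> continuous dQ ->
  (forall x, `|dQ x| <= C) ->
  l * variance_of Q <= \int[mu]_(x in I) (a x * dQ x ^+ 2).
Proof.
move=> QdQ cdQ dQC.
have C0 : 0 <= C by exact: le_trans (dQC 0).
have Im := mean_in hx hp.
have [a_ [b_ [ab am mb]]] := exhaustion Im.
have [Iab mono _ _ _] := ab.
pose T n := clamp (a_ n.+1) (a_ n) (b_ n) (b_ n.+1).
pose h n := trapezoid (a_ n.+1) (a_ n) (b_ n) (b_ n.+1).
have nodes n : [/\ a_ n.+1 < a_ n, a_ n <= b_ n & b_ n < b_ n.+1].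
  by have [? ?] := mono n; split => //; apply: ltW; apply: lt_trans (mb n).
have dT n (x : R) : is_derive x 1 (T n) (h n x) by exact: is_derive_clamp.
have hb n x : `|h n x| <= 1.
  by have /andP[? ?] := trapezoid_bounds x (nodes n); rewrite ger0_norm.
have ch n : continuous (h n) by exact: continuous_trapezoid.
have cT n : continuous (T n) by move=> x; exact: is_derive_continuous (dT n x).
pose Qn n := Q \o T n.
pose dQn n x := dQ (T n x) * h n x.
have dQnE n (x : R) : is_derive x 1 (Qn n) (dQn n x) by exact: is_derive1_comp.
have cdQn n : continuous (dQn n).
  move=> x; apply: continuousM; last exact: ch.
  by apply: continuous_comp; [exact: cT|exact: cdQ].
have dQnC n x : `|dQn n x| <= C.
  by rewrite normrM -[leRHS]mulr1 ler_pM.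
have cpt n : l * variance_of (Qn n) <= \int[mu]_(x in I) (a x * dQn n x ^+ 2).
  have [Ia Ib] := Iab n.+1.
  apply: rayleigh_variance_compact Ia Ib _ => // x xo.
  by rewrite /dQn /h trapezoid_out ?mulr0.
have cQ : continuous Q by move=> x; exact: is_derive_continuous (QdQ x).
have cQn n : continuous (Qn n) by move=> x; exact: is_derive_continuous (dQnE n x).
have LQ := derive_Lipschitz QdQ dQC.
(* the clamps are contractions fixing m1, whence a bound uniform in n *)
pose g x := C * `|x - m1| + `|Q m1|.
have Tm n : T n m1 = m1 by apply: clamp_in => //; apply/andP; split; exact: ltW.
have Qng n x : `|Qn n x| <= g x.
  rewrite -[Qn n x](subrK (Q m1)); apply: le_trans (ler_normD _ _) _.
  rewrite lerD2r; apply: le_trans (LQ _ _) _; apply: ler_wpM2l => //.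
  by rewrite -{1}(Tm n); exact: clamp_contraction.
have cg : continuous_on I g.
  move=> x _; apply: continuousD; last exact: cvg_cst.
  apply: continuousM; first exact: cvg_cst.
  apply: continuous_comp; last exact: norm_continuous.
  by apply: continuousB; [exact: cvg_id|exact: cvg_cst].
have gg : linear_growth g.
  apply: (@linear_growth_Lipschitz _ _ C) => x y.
  rewrite /g opprD addrACA subrr addr0 -mulrBr normrM (ger0_norm C0).
  apply: ler_wpM2l => //; apply: le_trans (ler_dist_dist _ _) _.
  by rewrite opprB addrA subrK.
have g0 x : 0 <= g x by rewrite addr_ge0 ?mulr_ge0.
have ev x : I x -> \forall n \near \oo, T n x = x /\ h n x = 1.
  move=> /(exhausts_near ab); apply: filterS => n [anx xbn].
  have xab : a_ n <= x <= b_ n by apply/andP; split; exact: ltW.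
  by split; [exact: clamp_in|exact: trapezoid_in].
have mp : continuous_on I p by move=> x; exact: density_continuous.
have cvg1 : E (Qn n) @[n --> \oo] --> E Q.
  apply: (@Rintegral_dominated_cvg _ _ _ _ (fun x => p x * g x)) => //.
  - by move=> n; apply: continuous_on_measurable => x Ix; apply: continuousM; [exact: mp|exact: cQn].
  - by apply: continuous_on_measurable => x Ix; apply: continuousM; [exact: mp|exact: cQ].
  - move=> x Ix; apply: cvg_near_cst; apply: filterS (ev x Ix) => n [Tx _].
    by rewrite /Qn /= Tx.
  - exact: density_integrable1.
  - move=> n x Ix; have p0 := density_gt0 hp Ix.
    by rewrite normrM gtr0_norm// ler_pM2l.
have cvg2 : E (fun x => Qn n x * Qn n x) @[n --> \oo] --> E (fun x => Q x * Q x).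
  apply: (@Rintegral_dominated_cvg _ _ _ _ (fun x => p x * (g x * g x))) => //.
  - by move=> n; apply: continuous_on_measurable => x Ix; apply: continuousM; [exact: mp|apply: continuousM; exact: cQn].
  - by apply: continuous_on_measurable => x Ix; apply: continuousM; [exact: mp|apply: continuousM; exact: cQ].
  - move=> x Ix; apply: cvg_near_cst; apply: filterS (ev x Ix) => n [Tx _].
    by rewrite /Qn /= Tx.
  - exact: density_integrableM.
  - move=> n x Ix; have p0 := density_gt0 hp Ix.
    by rewrite normrM gtr0_norm// ler_pM2l// normrM ler_pM.
have cvg3 : \int[mu]_(x in I) (a x * dQn n x ^+ 2) @[n --> \oo] -->
    \int[mu]_(x in I) (a x * dQ x ^+ 2).
  have ma : measurable_fun I a by apply/measurable_EFinP; exact: measurable_int ai.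
  apply: (@Rintegral_dominated_cvg _ _ _ _ (fun x => a x * C ^+ 2)) => //.
  - move=> n; apply: measurable_funM => //; apply: continuous_on_measurable => x _.
    by apply: continuous_sqr; exact: cdQn.
  - apply: measurable_funM => //; apply: continuous_on_measurable => x _.
    by apply: continuous_sqr; exact: cdQ.
  - move=> x Ix; apply: cvg_near_cst; apply: filterS (ev x Ix) => n [Tx hx1].
    by rewrite /dQn Tx hx1 mulr1.
  - by under eq_fun do rewrite mulrC; exact: integrable_scale.
  - move=> n x Ix; rewrite normrM (ger0_norm (a0 Ix)) ler_wpM2l ?a0//.
    by rewrite normrX lerXn2r ?nnegrE.
apply: (ler_cvg_to (f := fun n => l * variance_of (Qn n)) _ cvg3).
  apply: cvgM; first exact: cvg_cst.
  by apply: cvgB => //; rewrite /= expr2; under eq_fun do rewrite expr2; exact: cvgM.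
by apply: nearW.
Qed.

(** Under the hypothesis on the total conductance, the identity attains equality
    in [rayleigh_variance]; hence the derivative at [e = 0] of the difference of
    both sides along [x + e H x] vanishes. *)
Lemma first_variation (H eta : R -> R) (C : R) :
  \int[mu]_(x in I) a x = l * variance_of id ->
  (forall x : R, is_derive x 1 H (eta x)) -> continuous eta -> (forall x, `|eta x| <= C) ->
  \int[mu]_(x in I) (a x * eta x) = l * (E (fun x => x * H x) - E id * E H).
Proof.
move=> aV Heta ceta etaC.
have C0 : 0 <= C by exact: le_trans (etaC 0).
have cH : continuous_on I H by move=> x _; exact: is_derive_continuous (Heta x).
have gH : linear_growth H by exact: bounded_derive_growth etaC.
have cid : continuous_on I id by exact: continuous_on_id.
have gid := @linear_growth_id R.
have i1 := density_integrable1 hp cid gid.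
have iH := density_integrable1 hp cH gH.
have i11 := density_integrableM hp cid cid gid gid.
have i1H := density_integrableM hp cid cH gid gH.
have iHH := density_integrableM hp cH cH gH gH.
have meta : measurable_fun I eta by apply: continuous_on_measurable => x _; exact: ceta.
have ja := integrable_mul_bounded mI ai meta (fun x _ => etaC x).
have jaa : mu.-integrable I (EFin \o (fun x => a x * (eta x * eta x))).
  apply: (@integrable_mul_bounded _ _ _ _ (C * C)) => //; first exact: measurable_funM.
  by move=> x _; rewrite normrM ler_pM.
apply/eqP; rewrite -subr_eq0; apply/eqP.
apply: (@quadratic_ge0_linear0 _ _ (\int[mu]_(x in I) (a x * (eta x * eta x)) - l * variance_of H)) => e.
pose Q x := x + e * H x; pose dQ x := 1 + e * eta x.
have QdQ (x : R) : is_derive x 1 Q (dQ x).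
  by rewrite /Q /dQ; apply: is_deriveD.
have cdQ : continuous dQ.
  move=> x; apply: cvgD; first exact: cvg_cst.
  by apply: cvgM; [exact: cvg_cst|exact: ceta].
have dQC x : `|dQ x| <= 1 + `|e| * C.
  apply: le_trans (ler_normD _ _) _; rewrite normr1 lerD2l normrM.
  by rewrite ler_wpM2l.
have := rayleigh_variance QdQ cdQ dQC.
have -> : \int[mu]_(x in I) (a x * dQ x ^+ 2) =
   \int[mu]_(x in I) a x + 2 * e * \int[mu]_(x in I) (a x * eta x)
     + e ^+ 2 * \int[mu]_(x in I) (a x * (eta x * eta x)).
  rewrite -!RintegralZl//.
  rewrite -!RintegralD//; try by (repeat (apply: integrable_add => //)); exact: integrable_scale.
  by apply: eq_Rintegral => x _; rewrite /dQ; ring.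
have EQ : E Q = E id + e * E H.
  rewrite -[E id]mul1r /E -expectation_lin//.
  by apply: eq_Rintegral => x _; rewrite mul1r.
have EQQ : E (fun x => Q x * Q x) = E (fun x => x * x) + 2 * e * E (fun x => x * H x)
    + e ^+ 2 * E (fun x => H x * H x).
  rewrite -[E (fun x => x * x)]mul1r -addrA -[X in _ + X]mul1r.
  rewrite /E -(@expectation_lin _ _ _ _ (2 * e) (e ^+ 2))// -expectation_lin//.
    by apply: eq_Rintegral => x _; congr (_ * _); rewrite /Q; ring.
  exact: expectation_lin_integrable.
rewrite /variance_of EQ EQQ aV /variance_of -subr_ge0 => h.
by apply: le_trans h _; rewrite le_eqVlt; apply/orP; left; apply/eqP; ring.
Qed.

End one_diffusion.

(** The right-hand side of [first_variation] does not involve the conductance, so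
    two conductances with the same optimal rate have the same integral against
    every continuous bump. *)
Lemma conductance_unique (d d' : diffusion R) (l : R) :
  (forall x, I x -> 0 <= conductance p d x) -> (forall x, I x -> 0 <= conductance p d' x) ->
  continuous_on I (conductance p d) -> continuous_on I (conductance p d') ->
  mu.-integrable I (EFin \o conductance p d) -> mu.-integrable I (EFin \o conductance p d') ->
  rayleigh_lower_bound x1 x2 p d l -> rayleigh_lower_bound x1 x2 p d' l ->
  \int[mu]_(x in I) conductance p d x = l * variance_of id ->
  \int[mu]_(x in I) conductance p d' x = l * variance_of id ->
  forall x, I x -> conductance p d x = conductance p d' x.
Proof.
suff wl (e e' : diffusion R) :
  (forall x, I x -> 0 <= conductance p e x) -> (forall x, I x -> 0 <= conductance p e' x) ->
  continuous_on I (conductance p e) -> continuous_on I (conductance p e') ->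
  mu.-integrable I (EFin \o conductance p e) -> mu.-integrable I (EFin \o conductance p e') ->
  rayleigh_lower_bound x1 x2 p e l -> rayleigh_lower_bound x1 x2 p e' l ->
  \int[mu]_(x in I) conductance p e x = l * variance_of id ->
  \int[mu]_(x in I) conductance p e' x = l * variance_of id ->
  forall x, I x -> conductance p e x <= conductance p e' x.
  move=> ? ? ? ? ? ? ? ? ? ? x Ix; apply/eqP; rewrite eq_le.
  by apply/andP; split; apply: wl.
move=> a0 a'0 ca ca' ai a'i LB LB' aV a'V x Ix; rewrite leNgt; apply/negP => xlt.
pose f x := conductance p e x - conductance p e' x.
have cf y : I y -> {for y, continuous f} by move=> Iy; apply: continuousB; [exact: ca|exact: ca'].
have : \forall y \near x, 0 < f y.
  have fx : 0 < f x by rewrite subr_gt0.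
  exact: (cvgr_gt _ (cf _ Ix) _ fx).
move=> fpos; have : \forall y \near x, 0 < f y /\ I y.
  by apply: filterS2 fpos (oint_nbhs Ix) => y; split.
move=> /nbhs_ballP[r /= r0 rf].
have near_f y : x - r / 2 <= y <= x + r / 2 -> 0 < f y /\ I y.
  by move=> yr; apply: rf; rewrite /ball /= ltr_distlC; apply/andP; split; lra.
have nodes : [/\ x - r / 2 < x - r / 4, x - r / 4 <= x + r / 4 & x + r / 4 < x + r / 2].
  by split; lra.
pose eta := trapezoid (x - r / 2) (x - r / 4) (x + r / 4) (x + r / 2).
have etab y : 0 <= eta y <= 1 by exact: trapezoid_bounds.
have etaC y : `|eta y| <= 1 by have /andP[? ?] := etab y; rewrite ger0_norm.
have dH y := is_derive_clamp y nodes.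
have ceta : continuous eta by exact: continuous_trapezoid.
have meta : measurable_fun I eta by apply: continuous_on_measurable => y _; exact: ceta.
have V1 := first_variation ai a0 LB aV dH ceta etaC.
have V2 := first_variation a'i a'0 LB' a'V dH ceta etaC.
have j1 := integrable_mul_bounded mI ai meta (fun x _ => etaC x).
have j2 := integrable_mul_bounded mI a'i meta (fun x _ => etaC x).
have : 0 < \int[mu]_(y in I) (conductance p e y * eta y - conductance p e' y * eta y).
  apply: (@Rintegral_gt0 R I _ (x - r / 4) (x + r / 4)) => //.
  - rewrite (_ : _ \o _ = EFin \o (fun y => conductance p e y * eta y + -1 * (conductance p e' y * eta y))).
      by apply: integrable_add => //; exact: integrable_scale.
    by apply/funext => y /=; rewrite mulN1r.
  - move=> y Iy; rewrite -mulrBl.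
    have [yr|yr] := boolP (x - r / 2 <= y <= x + r / 2).
      by have [f0 _] := near_f _ yr; apply: mulr_ge0; [exact: ltW|have /andP[] := etab y].
    rewrite /eta trapezoid_out ?mulr0//.
    move: yr; rewrite negb_and -!ltNge => /orP[]/ltW; [by left|by right].
  - lra.
  - by move=> y /=; rewrite in_itv /= => yr; have [] // := near_f y; lra.
  - move=> y yr; have [f0 Iy] : 0 < f y /\ I y by apply: near_f; lra.
    split; first by rewrite -mulrBl /eta trapezoid_in// mulr1.
    apply: continuousB; apply: continuousM; [exact: ca| |exact: ca'|]; exact: ceta.
by rewrite RintegralB// V1 V2 subrr ltxx.
Qed.

End Rayleigh.

(** * The optimal weight and its Poincare inequality *)

Section Primitive.
Variables (R : realType) (x1 x2 : \bar R).
Hypothesis hx : (x1 < x2)%E.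
Notation mu := (@lebesgue_measure R).
Notation I := (oint x1 x2).
Let mI : measurable I := @measurable_oint R x1 x2.
Variable f : R -> R.
Hypotheses (cf : continuous_on I f) (fi : mu.-integrable I (EFin \o f)).
Notation F := (integral_from x1 f).

Lemma sub_oint_from u : I u -> [set z : R | (x1 < z%:E <= u%:E)%E] `<=` I.
Proof.
move=> /andP[_ ux2] z /= /andP[x1z zu]; apply/andP; split => //.
exact: le_lt_trans zu ux2.
Qed.

Lemma is_derive_integral_from x : I x -> is_derive x 1 F (f x).
Proof.
move=> Ix; have [l [setE lr]] := integral_from_domain hx.
have [b [Ib _ xb _]] := exhaustion_right Ix.
have lx := lr _ Ix.
have [|dF dFE] := @continuous_FTC1 R f l x (b 0%N) (xb 0%N) _ lx (cf Ix).
  rewrite -setE//; apply: integrableS fi => //; last exact: sub_oint_from.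
  by rewrite setE//; exact: measurable_itv.
apply: (@near_eq_is_derive _ _ _ (fun y => \int[mu]_(t in [set` Interval l (BRight y)]) f t)).
- near=> y; rewrite /integral_from setE//; near: y; exact: oint_nbhs.
- by apply: DeriveDef; [exact: dF|rewrite -derive1E; exact: dFE].
Unshelve. all: by end_near. Qed.

Lemma integral_from_sub a b : I a -> I b -> a <= b ->
  \int[mu]_(x in `[a, b]) f x = F b - F a.
Proof.
move=> Ia Ib ab; have Iab x : a <= x <= b -> I x by exact: oint_between.
apply: Rintegral_FTC2 => //.
- by move=> x /Iab; exact: cf.
- by move=> x /Iab Ix; exact: is_derive_continuous (is_derive_integral_from Ix).
- move=> x /andP[ax xb]; apply: is_derive_integral_from; apply: Iab.
  by apply/andP; split; exact: ltW.
Qed.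

Lemma Rintegral_exhausts (a b : nat -> R) : exhausts x1 x2 a b ->
  \int[mu]_(x in `[a n, b n]) f x @[n --> \oo] --> \int[mu]_(x in I) f x.
Proof.
move=> ab; apply: Rintegral_cvg_sets => //.
- by move=> n x /=; rewrite in_itv /=; exact: (exhausts_mem ab).
- move=> x /(exhausts_near ab); apply: filterS => n [ax xb] /=.
  by rewrite in_itv /= !ltW.
Qed.

Lemma integral_from_right (a b : nat -> R) : exhausts x1 x2 a b ->
  F (b n) @[n --> \oo] --> \int[mu]_(x in I) f x.
Proof.
move=> ab; have [Iab _ _ _ _] := ab; apply: Rintegral_cvg_sets => //.
- move=> n; have [_ Ib] := Iab n.
  have [l [setE _]] := integral_from_domain hx; rewrite setE//; exact: measurable_itv.
- by move=> n; have [_ Ib] := Iab n; exact: sub_oint_from.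
- move=> x Ix; have := exhausts_near ab Ix; apply: filterS => n [_ xb] /=.
  by have /andP[-> _] := Ix; rewrite lee_fin ltW.
Qed.

(** The boundary value is obtained as the difference between the integral over
    the interval and the limit of the integrals over the exhausting segments. *)
Lemma integral_from_left (a b : nat -> R) : exhausts x1 x2 a b ->
  F (a n) @[n --> \oo] --> (0 : R).
Proof.
move=> ab; have [Iab _ ltab _ _] := ab.
rewrite -(subrr (\int[mu]_(x in I) f x)).
have aE : (fun n => F (a n)) = (fun n => F (b n) - \int[mu]_(x in `[a n, b n]) f x).
  apply/funext => n /=; have [Ia Ib] := Iab n.
  by rewrite integral_from_sub ?ltW//; ring.
rewrite aE; apply: cvgB; [exact: integral_from_right ab|exact: Rintegral_exhausts].
Qed.

End Primitive.

Section Weight.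
Variables (R : realType) (x1 x2 : \bar R) (p : R -> R).
Hypotheses (hx : (x1 < x2)%E) (hp : stationary_density x1 x2 p).
Notation mu := (@lebesgue_measure R).
Notation I := (oint x1 x2).
Notation m1 := (moment x1 x2 p 1).
Let mI : measurable I := @measurable_oint R x1 x2.

(** The solution of [a' = (m1 - x) p] that vanishes at [x1]. This is the equation
    which makes [x - m1] an eigenfunction, with eigenvalue one, of the operator
    with conductance [a]. *)
Definition optimal_weight : R -> R := integral_from x1 (fun z => (m1 - z) * p z).
Notation G := optimal_weight.
Let f z := (m1 - z) * p z.

Let cp : continuous_on I p.
Proof. by move=> x; exact: density_continuous. Qed.

Let cf : continuous_on I f.
Proof.
move=> x Ix; apply: continuousM; last exact: cp.
by apply: continuousB; [exact: cvg_cst|exact: cvg_id].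
Qed.

Let fE : f = (fun x => -1 * (p x * (x - m1))).
Proof. by apply/funext => x; rewrite /f; ring. Qed.

Let im : mu.-integrable I (EFin \o (fun x => p x * (x - m1))).
Proof.
apply: density_integrable1 => //.
  by move=> x _; apply: continuousB; [exact: cvg_id|exact: cvg_cst].
by apply: linear_growthD; [exact: linear_growth_id|exact: linear_growth_cst].
Qed.

Let fi : mu.-integrable I (EFin \o f).
Proof. by rewrite fE; apply: integrable_scale. Qed.

Let f0 : \int[mu]_(x in I) f x = 0.
Proof. by rewrite fE RintegralZl// (expectation_centered hp) mulr0. Qed.

Lemma is_derive_optimal_weight x : I x -> is_derive x 1 G ((m1 - x) * p x).
Proof. exact: is_derive_integral_from. Qed.

Lemma continuous_optimal_weight : continuous_on I G.
Proof. by move=> x Ix; exact: is_derive_continuous (is_derive_optimal_weight Ix). Qed.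

Lemma optimal_weight_homo_left x y : I x -> I y -> x < y -> y <= m1 -> G x < G y.
Proof.
move=> Ix Iy xy ym; rewrite -subr_gt0 -(integral_from_sub hx cf fi Ix Iy (ltW xy)).
have Ixy z : x <= z <= y -> I z by exact: oint_between.
apply: (@Rintegral_gt0 R _ _ x ((x + y) / 2)) => //.
- by apply: continuous_itv_integrable => z /Ixy; exact: cf.
- move=> z /=; rewrite in_itv /= => zxy; apply: mulr_ge0.
    by rewrite subr_ge0; case/andP: zxy => _ /le_trans; apply.
  exact: ltW (density_gt0 hp (Ixy _ zxy)).
- lra.
- by move=> z /=; rewrite !in_itv /=; lra.
- move=> z zxy; have Iz : I z by apply: Ixy; lra.
  split; last exact: cf.
  by rewrite mulr_gt0 ?(density_gt0 hp Iz)// subr_gt0; lra.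
Qed.

Lemma optimal_weight_homo_right x y : I x -> I y -> x < y -> m1 <= x -> G y < G x.
Proof.
move=> Ix Iy xy mx; rewrite -subr_gt0 -opprB -(integral_from_sub hx cf fi Ix Iy (ltW xy)).
have Ixy z : x <= z <= y -> I z by exact: oint_between.
have ci : mu.-integrable `[x, y] (EFin \o f).
  by apply: continuous_itv_integrable => z /Ixy; exact: cf.
rewrite -mulN1r -RintegralZl//.
apply: (@Rintegral_gt0 R _ _ ((x + y) / 2) y) => //.
- exact: integrable_scale.
- move=> z /=; rewrite in_itv /= => zxy; rewrite mulN1r -mulNr opprB; apply: mulr_ge0.
    by rewrite subr_ge0; case/andP: zxy => + _; exact: le_trans.
  exact: ltW (density_gt0 hp (Ixy _ zxy)).
- lra.
- by move=> z /=; rewrite !in_itv /=; lra.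
- move=> z zxy; have Iz : I z by apply: Ixy; lra.
  split; last by apply: cvgM; [exact: cvg_cst|exact: cf].
  by rewrite mulN1r -mulNr opprB mulr_gt0 ?(density_gt0 hp Iz)// subr_gt0; lra.
Qed.

(** The weight increases from the limit 0 up to the mean, and then decreases to
    the limit 0, because the integral of [(m1 - z) p] over the interval is 0. *)
Lemma optimal_weight_gt0 x : I x -> 0 < G x.
Proof.
move=> Ix; have [a [b [ab ax xb]]] := exhaustion Ix.
have [Iab mono _ _ _] := ab.
have [Ia Ib] := Iab 0%N.
have Ga := integral_from_left hx cf fi ab; have Gb := integral_from_right hx fi ab.
rewrite f0 in Gb.
have mon n := exhausts_nondecreasing ab (leq0n n).
have [xm|/ltW mx] := leP x m1.
- apply: (@le_lt_trans _ _ (G (a 0%N))); last exact: optimal_weight_homo_left.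
  apply: (cvgr_to_le Ga); apply: nearW => n.
  have [+ _] := mon n; rewrite le_eqVlt => /predU1P[->//|h].
  have [Ian _] := Iab n; apply/ltW/optimal_weight_homo_left => //.
  exact: le_trans (ltW (ax 0%N)) xm.
- apply: (@le_lt_trans _ _ (G (b 0%N))); last exact: optimal_weight_homo_right.
  apply: (cvgr_to_le Gb); apply: nearW => n.
  have [_ +] := mon n; rewrite le_eqVlt => /predU1P[->//|h].
  have [_ Ibn] := Iab n; apply/ltW/optimal_weight_homo_right => //.
  exact: le_trans mx (ltW (xb 0%N)).
Qed.

Lemma optimal_weight_left_end : G @ to_left_end x1 --> (0 : R).
Proof.
have Im := mean_in hx hp; have [a [b [ab am mb]]] := exhaustion Im.
have [Iab _ _ _ _] := ab.
have Ga := integral_from_left hx cf fi ab.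
apply/cvgr0Pnorm_lt => e e0.
near \oo => n.
have Gan : G (a n) < e by near: n; exact: (cvgr_lt _ Ga).
have [Ia _] := Iab n.
apply: filterS (near_left_end Ia) => y [Iy ya].
rewrite gtr0_norm; last exact: optimal_weight_gt0.
by apply: lt_trans Gan; apply: optimal_weight_homo_left => //; exact: ltW.
Unshelve. all: by end_near. Qed.

Lemma optimal_weight_right_end : G @ to_right_end x2 --> (0 : R).
Proof.
have Im := mean_in hx hp; have [a [b [ab am mb]]] := exhaustion Im.
have [Iab _ _ _ _] := ab.
have Gb := integral_from_right hx fi ab; rewrite f0 in Gb.
apply/cvgr0Pnorm_lt => e e0.
near \oo => n.
have Gan : G (b n) < e by near: n; exact: (cvgr_lt _ Gb).
have [_ Ib] := Iab n.
apply: filterS (near_right_end Ib) => y [Iy ya].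
rewrite gtr0_norm; last exact: optimal_weight_gt0.
by apply: lt_trans Gan; apply: optimal_weight_homo_right => //; exact: ltW.
Unshelve. all: by end_near. Qed.

Section Poincare.
Variable Q : R -> R.
Hypothesis CQ : continuously_differentiable_on I Q.
Notation r := (secant_slope Q m1).

Let dQ x (Ix : I x) : is_derive x 1 Q (derive1 Q x).
Proof. by have [d _] := CQ; apply: DeriveDef; [exact: d|rewrite derive1E]. Qed.

Lemma continuous_on_secant_slope : continuous_on I r.
Proof.
move=> x Ix; have [->|xm] := eqVneq x m1.
  by apply: continuous_secant_slope; have [d _] := CQ; exact: d (mean_in hx hp).
exact: is_derive_continuous (is_derive_secant_slope xm (dQ Ix)).
Qed.

(** This function has the sign of [x - m1], so its increment over a segment that
    contains [m1] is nonnegative whatever [Q] does at the ends. *)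
Let W x := G x * r x ^+ 2 * (x - m1).

(** At [m1] itself [W] is differentiable although the secant slope may not be. *)
Let dW x : I x -> is_derive x 1 W
  (G x * derive1 Q x ^+ 2 - (p x * (Q x - Q m1) ^+ 2 + G x * (derive1 Q x - r x) ^+ 2)).
Proof.
move=> Ix; have [xm|xm] := eqVneq x m1.
  have -> : G x * derive1 Q x ^+ 2 - (p x * (Q x - Q m1) ^+ 2 + G x * (derive1 Q x - r x) ^+ 2) = G m1 * r m1 ^+ 2.
    by rewrite xm /secant_slope eqxx; ring.
  rewrite /W xm; apply: (@is_derive_mul_subr R (fun x => G x * r x ^+ 2)).
  rewrite xm in Ix; apply: continuousM; first exact: continuous_optimal_weight.
  by apply: continuous_sqr; exact: continuous_on_secant_slope.
have dG := is_derive_optimal_weight Ix.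
have dr := is_derive_secant_slope xm (dQ Ix).
apply: is_derive_eq; rewrite secant_slopeE /GRing.scale /=.
by field; rewrite subr_eq0.
Qed.

(** Integration over segments around the mean of the identity
    [W' = G Q'^2 - p (Q - Q m1)^2 - G (Q' - r)^2], where [W = G r^2 (x - m1)]. The
    inequality keeps the defect [G (Q' - r)^2], which vanishes identically only
    for affine functions [Q]. *)
Lemma poincare :
  (\int[mu]_(x in I) (p x * (Q x - Q m1) ^+ 2 + G x * (derive1 Q x - r x) ^+ 2)%:E
    <= \int[mu]_(x in I) (G x * derive1 Q x ^+ 2)%:E)%E.
Proof.
have [_ cQ'] := CQ.
have Im := mean_in hx hp; have [a [b [ab am mb]]] := exhaustion Im.
have [Iab _ ltab _ _] := ab.
have cQ : continuous_on I Q by move=> x Ix; exact: is_derive_continuous (dQ Ix).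
have cR : continuous_on I (fun x => G x * derive1 Q x ^+ 2).
  move=> x Ix; apply: continuousM; first exact: continuous_optimal_weight.
  by apply: continuous_sqr; exact: cQ'.
have cL : continuous_on I (fun x => p x * (Q x - Q m1) ^+ 2 + G x * (derive1 Q x - r x) ^+ 2).
  move=> x Ix; apply: continuousD; apply: continuousM.
  - exact: cp.
  - by apply: continuous_sqr; apply: continuousB; [exact: cQ|exact: cvg_cst].
  - exact: continuous_optimal_weight.
  - by apply: continuous_sqr; apply: continuousB; [exact: cQ'|exact: continuous_on_secant_slope].
have L0 x : I x -> 0 <= p x * (Q x - Q m1) ^+ 2 + G x * (derive1 Q x - r x) ^+ 2.
  move=> Ix; apply: addr_ge0; apply: mulr_ge0; rewrite ?sqr_ge0//.
    exact: ltW (density_gt0 hp Ix).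
  exact: ltW (optimal_weight_gt0 Ix).
have R0 x : I x -> 0 <= G x * derive1 Q x ^+ 2.
  by move=> Ix; apply: mulr_ge0; [exact: ltW (optimal_weight_gt0 Ix)|exact: sqr_ge0].
apply: (cvge_to_le (@ge0_integral_exhausts _ _ _ _ _ ab _ _ _)).
- by apply/measurable_EFinP; exact: continuous_on_measurable.
- by move=> x Ix; rewrite lee_fin; exact: L0.
apply: nearW => n; have [Ia Ib] := Iab n.
have Iabn x : a n <= x <= b n -> I x by exact: oint_between.
have iL := continuous_itv_integrable (fun x h => cL x (Iabn x h)).
have iR := continuous_itv_integrable (fun x h => cR x (Iabn x h)).
apply: (@le_trans _ _ (\int[mu]_(x in `[a n, b n]) (G x * derive1 Q x ^+ 2)%:E)%E); last first.
  apply: ge0_subset_integral => //.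
  by apply/measurable_EFinP; exact: continuous_on_measurable.
rewrite !integral_EFin_Rintegral// lee_fin -subr_ge0 -RintegralB//.
have -> : \int[mu]_(x in `[a n, b n]) (G x * derive1 Q x ^+ 2
    - (p x * (Q x - Q m1) ^+ 2 + G x * (derive1 Q x - r x) ^+ 2)) = W (b n) - W (a n).
  apply: Rintegral_FTC2.
  - exact: ltW.
  - by move=> x /Iabn Ix; apply: continuousB; [exact: cR|exact: cL].
  - by move=> x /Iabn Ix; exact: is_derive_continuous (dW Ix).
  - move=> x /andP[? ?]; apply: dW; apply: Iabn.
    by apply/andP; split; exact: ltW.
have Gr0 x : I x -> 0 <= G x * r x ^+ 2.
  by move=> Ix; apply: mulr_ge0; [exact: ltW (optimal_weight_gt0 Ix)|exact: sqr_ge0].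
rewrite subr_ge0; apply: (@le_trans _ _ 0).
  by apply: mulr_ge0_le0; [exact: Gr0|rewrite subr_le0 ltW].
by apply: mulr_ge0; [exact: Gr0|rewrite subr_ge0 ltW].
Qed.

End Poincare.
End Weight.

(** * Energy of eigenfunctions *)

Section Eigenfunction.
Variables (R : realType) (x1 x2 : \bar R) (p : R -> R).
Hypotheses (hx : (x1 < x2)%E) (hp : stationary_density x1 x2 p).
Notation mu := (@lebesgue_measure R).
Notation I := (oint x1 x2).
Let mI : measurable I := @measurable_oint R x1 x2.
Variables (a phi dphi : R -> R) (l : R).
Hypotheses (ca : continuous_on I a) (a0 : forall x, I x -> 0 < a x).
Hypothesis dphiE : forall x, I x -> is_derive x 1 phi (dphi x).
Hypothesis fluxE : forall x, I x ->
  is_derive x 1 (fun y => a y * dphi y) (- (l * p x * phi x)).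
Hypotheses (flux_left : a x * dphi x @[x --> to_left_end x1] --> (0 : R))
  (flux_right : a x * dphi x @[x --> to_right_end x2] --> (0 : R)).
Hypotheses (l0 : 0 <= l) (phi2 : mu.-integrable I (EFin \o (fun x => p x * phi x ^+ 2))).

Let cp : continuous_on I p.
Proof. by move=> x; exact: density_continuous. Qed.

Let cphi : continuous_on I phi.
Proof. by move=> x Ix; exact: is_derive_continuous (dphiE Ix). Qed.

Lemma eigenfunction_C1 : continuous_on I dphi.
Proof.
move=> x Ix; have h : {for x, continuous (fun y => (a y * dphi y) * (a y)^-1)}.
  apply: continuousM; first exact: is_derive_continuous (fluxE Ix).
  by apply: continuousV; [rewrite gt_eqF// a0|exact: ca].
have {}h : a y * dphi y * (a y)^-1 @[y --> x] --> dphi x.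
  have -> : dphi x = a x * dphi x * (a x)^-1 by rewrite mulrAC divff ?mul1r// gt_eqF// a0.
  exact: h.
rewrite /prop_for /continuous_at.
apply: cvg_trans h; apply: near_eq_cvg; near=> y.
have Iy : I y by near: y; exact: oint_nbhs.
by rewrite mulrAC divff ?mul1r// gt_eqF// a0.
Unshelve. all: by end_near. Qed.

(** The flux is a primitive of [- l p phi] that vanishes at both ends. *)
Lemma eigenfunction_mean : l * \int[mu]_(x in I) (p x * phi x) = 0.
Proof.
have [c [_ [Ic _ _]]] := oint_ex hx; have [s [t [st _ _]]] := exhaustion Ic.
have [Ist _ ltst sl tr] := st.
have i1 := square_integrable_integrable hp cphi phi2.
have : \int[mu]_(x in `[s n, t n]) (p x * phi x) @[n --> \oo] --> \int[mu]_(x in I) (p x * phi x).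
  apply: Rintegral_cvg_sets => //.
  - by move=> n x /=; rewrite in_itv /=; exact: (exhausts_mem st).
  - move=> x /(exhausts_near st); apply: filterS => n [ax xb] /=.
    by rewrite in_itv /= !ltW.
move=> /(cvgM (cvg_cst (- l))) h1.
have h2 : (a (t n) * dphi (t n) - a (s n) * dphi (s n)) @[n --> \oo] --> (0 : R).
  rewrite -(subrr (0:R)); apply: cvgB.
    exact: (@cvg_comp _ _ _ t (fun x => a x * dphi x) _ _ _ tr flux_right).
  exact: (@cvg_comp _ _ _ s (fun x => a x * dphi x) _ _ _ sl flux_left).
apply/eqP; rewrite -oppr_eq0 -mulNr; apply/eqP.
apply: (cvg_unique _ h1); first exact: Rhausdorff.
apply: cvg_trans h2; apply: near_eq_cvg; apply: nearW => n /=.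
have [Is It] := Ist n.
have Istn x : s n <= x <= t n -> I x by exact: oint_between.
have cc x : s n <= x <= t n -> {for x, continuous (fun x => p x * phi x)}.
  by move=> /Istn Ix; apply: continuousM; [exact: cp|exact: cphi].
rewrite -RintegralZl//; last exact: continuous_itv_integrable.
apply/esym; apply: (@Rintegral_FTC2 _ _ (fun y => a y * dphi y)).
- exact: ltW.
- by move=> x xst; apply: continuousM; [exact: cvg_cst|exact: cc].
- by move=> x /Istn Ix; exact: is_derive_continuous (fluxE Ix).
- move=> x /andP[? ?]; have Ix : I x by apply: Istn; rewrite !ltW.
  by rewrite mulNr mulrA; exact: fluxE.
Qed.

(** Multiply the equation by [T phi], where [T] is a clamp of the identity to a
    bounded range, and integrate by parts. The boundary term tends to 0, since
    the flux does and [T] is bounded; with [phi] itself it might not. On a given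
    segment [T] is the identity on the values of [phi] once its range is large
    enough. *)
Lemma eigenfunction_energy :
  (\int[mu]_(x in I) (a x * dphi x ^+ 2)%:E <= (l * \int[mu]_(x in I) (p x * phi x ^+ 2))%:E)%E.
Proof.
have [c [_ [Ic _ _]]] := oint_ex hx; have [s [t [st _ _]]] := exhaustion Ic.
have [Ist _ ltst sl tr] := st.
have cdphi := eigenfunction_C1.
have Istn n x : s n <= x <= t n -> I x by exact: (exhausts_mem st).
have cE : continuous_on I (fun x => a x * dphi x ^+ 2).
  by move=> x Ix; apply: continuousM; [exact: ca|apply: continuous_sqr; exact: cdphi].
apply: (cvge_to_le (@ge0_integral_exhausts _ _ _ _ _ st _ _ _)).
- by apply/measurable_EFinP; exact: continuous_on_measurable.
- by move=> x Ix; rewrite lee_fin mulr_ge0 ?sqr_ge0// ltW// a0.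
apply: nearW => m.
rewrite integral_EFin_Rintegral//; last first.
  by apply: continuous_itv_integrable => x /Istn; exact: cE.
rewrite lee_fin.
have [N N0 phiN] : exists2 N : R, 0 < N & forall x, s m <= x <= t m -> `|phi x| <= N.
  have [|z zst zmax] := @EVT_max R (fun x => `|phi x|) (s m) (t m) (ltW (ltst m)).
    apply: continuous_itv_within => x /Istn Ix.
    by apply: continuous_comp; [exact: cphi|exact: norm_continuous].
  exists (`|phi z| + 1); first by rewrite ltr_wpDl.
  move=> x xst; apply: le_trans (zmax x _) _; first by rewrite in_itv.
  by rewrite lerDl.
pose T := clamp (- N - 1) (- N) N (N + 1).
pose h := trapezoid (- N - 1) (- N) N (N + 1).
have nodes : [/\ - N - 1 < - N, - N <= N & N < N + 1] by split; lra.
have dT (x : R) : is_derive x 1 T (h x) by exact: is_derive_clamp.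
have cT (x : R) : {for x, continuous T} by exact: is_derive_continuous (dT x).
have ch : continuous h by exact: continuous_trapezoid.
have hb x : 0 <= h x <= 1 by exact: trapezoid_bounds.
have TN x : `|T x| <= N + 1.
  by have := clamp_bounds x nodes; rewrite ler_norml -/T; lra.
have Ty y : y * T y <= y ^+ 2.
  have T0 : T 0 = 0 by apply: clamp_in => //; apply/andP; split; lra.
  have := clamp_contraction y 0 nodes; rewrite -/T T0 !subr0 => Tyy.
  apply: le_trans (ler_norm _) _; rewrite normrM expr2 -[y * y]ger0_norm -?expr2 ?sqr_ge0//.
  by rewrite expr2 normrM ler_wpM2l.
pose F x := a x * dphi x * T (phi x).
pose e x := a x * dphi x ^+ 2 * h (phi x).
pose g x := p x * (phi x * T (phi x)).
have dTphi x : I x -> is_derive x 1 (fun y => T (phi y)) (h (phi x) * dphi x).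
  by move=> Ix; exact: (is_derive1_comp (dT _) (dphiE Ix)).
have cTphi : continuous_on I (fun y => T (phi y)).
  by move=> x Ix; exact: is_derive_continuous (dTphi x Ix).
have dF x : I x -> is_derive x 1 F (e x - l * g x).
  move=> Ix; have d1 := fluxE Ix; have d2 := dTphi x Ix.
  have -> : e x - l * g x = (a x * dphi x) *: (h (phi x) * dphi x) + T (phi x) *: - (l * p x * phi x).
    by rewrite /e /g /GRing.scale /=; ring.
  exact: (@is_deriveM _ _ (fun y => a y * dphi y) (fun y => T (phi y)) x 1 _ _ d1 d2).
have ce : continuous_on I e.
  move=> x Ix; apply: continuousM; first exact: cE.
  by apply: continuous_comp; [exact: cphi|exact: ch].
have cg : continuous_on I g.
  move=> x Ix; apply: continuousM; first exact: cp.
  by apply: continuousM; [exact: cphi|exact: cTphi].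
have F0 : F (t n) - F (s n) @[n --> \oo] --> (0 : R).
  have bnd (u : nat -> R) : a (u n) * dphi (u n) @[n --> \oo] --> (0 : R) ->
      F (u n) @[n --> \oo] --> (0 : R).
    move=> hu; apply/cvgr0Pnorm_le => eps eps0.
    have N1 : 0 < N + 1 by lra.
    move/cvgr0Pnorm_le : hu => /(_ (eps / (N + 1)) (divr_gt0 eps0 N1)).
    apply: filterS => n hn; rewrite /F normrM -[eps](divfK (lt0r_neq0 N1)).
    by apply: ler_pM.
  rewrite -(subrr (0:R)); apply: cvgB; apply: bnd.
    exact: (@cvg_comp _ _ _ t (fun x => a x * dphi x) _ _ _ tr flux_right).
  exact: (@cvg_comp _ _ _ s (fun x => a x * dphi x) _ _ _ sl flux_left).
have key n : (m <= n)%N -> \int[mu]_(x in `[s m, t m]) (a x * dphi x ^+ 2) <=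
    F (t n) - F (s n) + l * \int[mu]_(x in I) (p x * phi x ^+ 2).
  move=> mn; have [Is It] := Ist n.
  have [snm tmn] := exhausts_nondecreasing st mn.
  have ien : mu.-integrable `[s n, t n] (EFin \o e).
    by apply: continuous_itv_integrable => x /Istn; exact: ce.
  have ign : mu.-integrable `[s n, t n] (EFin \o g).
    by apply: continuous_itv_integrable => x /Istn; exact: cg.
  have sub : `[s m, t m] `<=` `[s n, t n].
    by move=> x /=; rewrite !in_itv /= => /andP[? ?]; apply/andP; split; lra.
  have e0 x : I x -> 0 <= e x.
    move=> Ix; apply: mulr_ge0; last by have /andP[] := hb (phi x).
    by rewrite mulr_ge0 ?sqr_ge0// ltW// a0.
  have st1 : \int[mu]_(x in `[s m, t m]) (a x * dphi x ^+ 2) = \int[mu]_(x in `[s m, t m]) e x.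
    apply: eq_Rintegral => x; rewrite inE /= in_itv /= => /phiN.
    by rewrite ler_norml => hN; rewrite /e /h trapezoid_in// mulr1.
  have st2 : \int[mu]_(x in `[s m, t m]) e x <= \int[mu]_(x in `[s n, t n]) e x.
    have iem : mu.-integrable `[s m, t m] (EFin \o e) by exact: integrableS ien.
    rewrite -lee_fin -!integral_EFin_Rintegral//; apply: ge0_subset_integral => //.
    - exact: measurable_int ien.
    - by move=> x /=; rewrite in_itv /= => /Istn; exact: e0.
  have st3 : \int[mu]_(x in `[s n, t n]) e x - l * \int[mu]_(x in `[s n, t n]) g x = F (t n) - F (s n).
    rewrite -RintegralZl// -RintegralB//; last exact: integrable_scale.
    apply: Rintegral_FTC2.
    - exact: ltW.
    - move=> x /Istn Ix; apply: continuousB; first exact: ce.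
      by apply: continuousM; [exact: cvg_cst|exact: cg].
    - by move=> x /Istn Ix; exact: is_derive_continuous (dF x Ix).
    - by move=> x /andP[? ?]; apply: dF; apply: (Istn n); rewrite !ltW.
  have i2n : mu.-integrable `[s n, t n] (EFin \o (fun x => p x * phi x ^+ 2)).
    by apply: integrableS phi2 => // x /=; rewrite in_itv /=; exact: Istn.
  have st4 : \int[mu]_(x in `[s n, t n]) g x <= \int[mu]_(x in I) (p x * phi x ^+ 2).
    apply: (@le_trans _ _ (\int[mu]_(x in `[s n, t n]) (p x * phi x ^+ 2))).
      apply: le_Rintegral => // x /=; rewrite in_itv /= => /Istn Ix.
      by apply: ler_wpM2l; [exact: ltW (density_gt0 hp Ix)|exact: Ty].
    rewrite -lee_fin -!integral_EFin_Rintegral//; apply: ge0_subset_integral => //.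
    - exact: measurable_int phi2.
    - by move=> x Ix; rewrite lee_fin mulr_ge0 ?sqr_ge0// ltW// (density_gt0 hp Ix).
    - by move=> x /=; rewrite in_itv /=; exact: Istn.
  rewrite st1 (le_trans st2)// -st3 -addrA lerDl addrC subr_ge0.
  exact: ler_wpM2l.
have lim : F (t n) - F (s n) + l * \int[mu]_(x in I) (p x * phi x ^+ 2) @[n --> \oo]
    --> 0 + l * \int[mu]_(x in I) (p x * phi x ^+ 2).
  by apply: cvgD => //; exact: cvg_cst.
rewrite add0r in lim; apply: (cvgr_to_ge lim).
by exists m => // n /= /key.
Qed.

End Eigenfunction.

(** * The optimal weight as an iterated integral *)

Section Iterated.
Variables (R : realType) (x1 x2 : \bar R) (p : R -> R).
Hypotheses (hx : (x1 < x2)%E) (hp : stationary_density x1 x2 p).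
Notation mu := (@lebesgue_measure R).
Notation I := (oint x1 x2).
Let mI : measurable I := @measurable_oint R x1 x2.
Notation P := (integral_from x1 p).

Let cp : continuous_on I p.
Proof. by move=> x; exact: density_continuous. Qed.

Let ip : mu.-integrable I (EFin \o p) := density_integrable hp.

Let ik x : mu.-integrable I (EFin \o (fun z => (x - z) * p z)).
Proof.
have -> : (fun z => (x - z) * p z) = (fun z => p z * (x * 1 + -1 * z)).
  by apply/funext => z; ring.
apply: expectation_lin_integrable; apply: density_integrable1 => //.
- exact: continuous_on_cst.
- exact: linear_growth_cst.
- exact: continuous_on_id.
- exact: linear_growth_id.
Qed.

Lemma measurable_from u : I u -> measurable [set z : R | (x1 < z%:E <= u%:E)%E].
Proof.
by move=> Iu; have [l [setE _]] := integral_from_domain hx; rewrite setE//; exact: measurable_itv.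
Qed.

(** Integration by parts on [[a, x]] leaves the boundary term [(x - a) P a], which
    is at most the integral of [(x - z) p] up to [a], hence negligible as [a]
    tends to the left end, even if that end is infinite. *)
Lemma integral_from_iterated x : I x ->
  integral_from x1 P x = integral_from x1 (fun z => (x - z) * p z) x.
Proof.
move=> Ix; pose k z := (x - z) * p z.
have ck : continuous_on I k.
  move=> z Iz; apply: continuousM; last exact: cp.
  by apply: continuousB; [exact: cvg_cst|exact: cvg_id].
have ikx : mu.-integrable I (EFin \o k) := ik x.
have [a [b [ab ax xb]]] := exhaustion Ix.
have [Iab _ _ _ _] := ab.
have subI := sub_oint_from Ix; have mD := measurable_from Ix.
have Ian n z : a n <= z <= x -> I z by have [Ia _] := Iab n; exact: oint_between.
have dP z : I z -> is_derive z 1 P (p z) by exact: is_derive_integral_from.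
have cP : continuous_on I P by move=> z Iz; exact: is_derive_continuous (dP z Iz).
have P0 z : I z -> 0 <= P z.
  by move=> Iz; apply: Rintegral_ge0 => y /(sub_oint_from Iz) Iy; exact: ltW (density_gt0 hp Iy).
have parts n : \int[mu]_(z in `[a n, x]) P z =
    \int[mu]_(z in `[a n, x]) k z + (x - a n) * P (a n).
  have iP : mu.-integrable `[a n, x] (EFin \o P).
    by apply: continuous_itv_integrable => z /Ian; exact: cP.
  have ikn : mu.-integrable `[a n, x] (EFin \o k).
    by apply: continuous_itv_integrable => z /Ian; exact: ck.
  apply/eqP; rewrite addrC -subr_eq -RintegralB//; apply/eqP.
  pose W z := (z - x) * P z.
  have -> : (x - a n) * P (a n) = W x - W (a n) by rewrite /W; ring.
  have dW z : I z -> is_derive z 1 W (P z - k z).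
    move=> Iz; have dPz := dP z Iz.
    by apply: is_derive_eq; rewrite /k /GRing.scale /=; ring.
  apply: Rintegral_FTC2.
  - exact: ltW.
  - by move=> z /Ian Iz; apply: continuousB; [exact: cP|exact: ck].
  - by move=> z /Ian Iz; exact: is_derive_continuous (dW z Iz).
  - by move=> z /andP[? ?]; apply: dW; apply: (Ian n); rewrite !ltW.
have bdry : (x - a n) * P (a n) @[n --> \oo] --> (0 : R).
  apply: (@squeeze_cvgr _ _ _ _ (fun=> 0) (fun n => integral_from x1 k (a n))).
  - apply: nearW => n; have [Ia _] := Iab n.
    apply/andP; split; first by apply: mulr_ge0; [rewrite subr_ge0 ltW|exact: P0].
    rewrite /integral_from -RintegralZl//; [|exact: measurable_from|]; last first.
      by apply: integrableS ip => //; [exact: measurable_from|exact: sub_oint_from].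
    apply: le_Rintegral; first exact: measurable_from.
    + apply: integrable_scale; first exact: measurable_from.
      by apply: integrableS ip => //; [exact: measurable_from|exact: sub_oint_from].
    + by apply: integrableS ikx => //; [exact: measurable_from|exact: sub_oint_from].
    + move=> z hz; have Iz := sub_oint_from Ia hz.
      apply: ler_wpM2r; first exact: ltW (density_gt0 hp Iz).
      by move: hz => /andP[_]; rewrite lee_fin; lra.
  - exact: cvg_cst.
  - exact: (integral_from_left hx ck ikx ab).
have lim1 : \int[mu]_(z in `[a n, x]) P z @[n --> \oo] --> integral_from x1 k x.
  have aE := funext parts; rewrite aE -[integral_from x1 k x]addr0.
  apply: cvgD => //.
  apply: Rintegral_cvg_sets => //.
  - move=> n z /=; rewrite in_itv /= => /andP[az zx].
    have [/andP[x1a _] _] := Iab n; apply/andP; split; last by rewrite lee_fin.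
    by apply: lt_le_trans x1a _; rewrite lee_fin.
  - move=> z hz; have := exhausts_near ab (subI _ hz); apply: filterS => n [az _].
    by rewrite /= in_itv /= ltW//=; move: hz => /andP[_]; rewrite lee_fin.
  - exact: integrableS ikx.
have lim2 : (\int[mu]_(z in `[a n, x]) (P z)%:E @[n --> \oo] -->
    \int[mu]_(z in [set z : R | (x1 < z%:E <= x%:E)%E]) (P z)%:E)%E.
  apply: ge0_integral_cvg_sets => //.
  - move=> m n /(exhausts_nondecreasing ab)[h _]; apply/subsetPset => z /=.
    by rewrite !in_itv /= => /andP[az ->]; rewrite (le_trans h).
  - move=> n z /=; rewrite in_itv /= => /andP[az zx].
    have [/andP[x1a _] _] := Iab n; apply/andP; split; last by rewrite lee_fin.
    by apply: lt_le_trans x1a _; rewrite lee_fin.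
  - move=> z hz; have [n _ hn] := exhausts_near ab (subI _ hz); exists n.
    have [az _] := hn n (leqnn n).
    by rewrite /= in_itv /= ltW//=; move: hz => /andP[_]; rewrite lee_fin.
  - apply/measurable_EFinP; apply: measurable_funS (continuous_on_measurable cP) => //.
  - by move=> z /subI Iz; rewrite lee_fin; exact: P0.
rewrite /integral_from /Rintegral; apply: (congr1 fine (y := (integral_from x1 k x)%:E)).
apply: (cvg_unique _ lim2); first exact: ereal_hausdorff.
have : (\int[mu]_(z in `[a n, x]) P z)%:E @[n --> \oo] --> (integral_from x1 k x)%:E.
  by apply: cvg_EFin; [exact: nearW|exact: lim1].
apply: cvg_trans; apply: near_eq_cvg; apply: nearW => n /=.
rewrite integral_EFin_Rintegral//.
by apply: continuous_itv_integrable => z /Ian; exact: cP.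
Qed.

Lemma optimal_weightE x : I x ->
  optimal_weight x1 x2 p x =
  (moment x1 x2 p 1 - x) * P x + integral_from x1 P x.
Proof.
move=> Ix; rewrite integral_from_iterated//.
have mD := measurable_from Ix; have subI := sub_oint_from Ix.
have ipD : mu.-integrable [set z : R | (x1 < z%:E <= x%:E)%E] (EFin \o p) by exact: integrableS ip.
have ikD : mu.-integrable [set z : R | (x1 < z%:E <= x%:E)%E] (EFin \o (fun z => (x - z) * p z)).
  exact: integrableS (ik x).
rewrite /optimal_weight /integral_from -RintegralZl// -RintegralD//; last exact: integrable_scale.
by apply: eq_Rintegral => z _; ring.
Qed.

End Iterated.

(** * The optimal diffusion *)

Section Optimum.
Variables (R : realType) (x1 x2 : \bar R) (p : R -> R) (sh2 : R).
Hypotheses (hx : (x1 < x2)%E) (hp : stationary_density x1 x2 p) (hs : 0 < 2^-1 * sh2).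
Notation mu := (@lebesgue_measure R).
Notation I := (oint x1 x2).
Notation m1 := (moment x1 x2 p 1).
Notation m2 := (moment x1 x2 p 2).
Notation G := (optimal_weight x1 x2 p).
Notation E := (expectation x1 x2 p).
Notation V := (m2 - m1 ^+ 2).
Notation K := (sh2 / (2 * V)).
Notation phi1 := (fun x : R => (x - m1) / Num.sqrt V).
Let mI : measurable I := @measurable_oint R x1 x2.
Let cid : continuous_on I id := @continuous_on_id R x1 x2.
Let gid := @linear_growth_id R.

Lemma variance_id : variance_of x1 x2 p id = V.
Proof. by rewrite /variance_of /expectation moment1E moment2E. Qed.

Lemma variance_centered : \int[mu]_(x in I) (p x * (x - m1) ^+ 2) = V.
Proof.
rewrite -variance_id (variance_ofE hp cid gid) /expectation.
by apply: eq_Rintegral => x _; rewrite -moment1E.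
Qed.

Let csub : continuous_on I (fun x => x - m1).
Proof. by move=> x _; apply: continuousB; [exact: cvg_id|exact: cvg_cst]. Qed.

Let gsub : linear_growth (fun x => x - m1).
Proof. by apply: linear_growthD => //; exact: linear_growth_cst. Qed.

Let isub2 : mu.-integrable I (EFin \o (fun x => p x * (x - m1) ^+ 2)).
Proof. by under eq_fun do rewrite expr2; exact: density_integrableM. Qed.

Lemma variance_gt0 : 0 < V.
Proof.
have Im := mean_in hx hp; have [b [Ib _ mb _]] := exhaustion_right Im.
have bb : b 0%N < (b 0%N + b 0%N) / 2 + 1 by lra.
have c0 := mb 0%N; rewrite -variance_centered.
apply: (@Rintegral_gt0 R I _ ((m1 + b 0%N) / 2) (b 0%N)) => //.
- by move=> x Ix; apply: mulr_ge0; [exact: ltW (density_gt0 hp Ix)|exact: sqr_ge0].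
- lra.
- by move=> x /=; rewrite in_itv /= => h; apply: (oint_between Im (Ib 0%N)); lra.
- move=> x h; have Ix : I x by apply: (oint_between Im (Ib 0%N)); lra.
  split; first by rewrite mulr_gt0 ?(density_gt0 hp Ix)// exprn_gt0// subr_gt0; lra.
  apply: continuousM; first exact: density_continuous Ix.
  by apply: continuous_sqr; exact: csub.
Qed.

Lemma optimal_rate_gt0 : 0 < K.
Proof.
have V0 := variance_gt0; have s0 : 0 < sh2 by have h := hs; lra.
by rewrite divr_gt0 ?mulr_gt0.
Qed.

(** The function [x - m1] satisfies the Poincare inequality without defect and the
    energy bound with eigenvalue one: these are the two inequalities between the
    integral of the weight and the variance. *)
Lemma optimal_weight_integral :
  mu.-integrable I (EFin \o G) /\ \int[mu]_(x in I) G x = V.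
Proof.
have cG := continuous_optimal_weight hx hp.
have G0 x := @optimal_weight_gt0 _ _ _ _ hx hp x.
have up : (\int[mu]_(x in I) (G x)%:E <= V%:E)%E.
  have := @eigenfunction_energy R x1 x2 p hx hp G (fun x => x - m1) (fun=> 1) 1 cG G0.
  rewrite variance_centered mul1r; under eq_integral do rewrite expr1n mulr1.
  apply => //.
  - by move=> x Ix; apply: is_derive_eq; rewrite subr0.
  - move=> x Ix; under eq_fun do rewrite mulr1.
    by rewrite mul1r -mulrN opprB mulrC; exact: is_derive_optimal_weight.
  - by under eq_fun do rewrite mulr1; exact: optimal_weight_left_end.
  - by under eq_fun do rewrite mulr1; exact: optimal_weight_right_end.
have C1 : continuously_differentiable_on I id.
  split; first by move=> x _; exact: derivable_id.
  rewrite (_ : derive1 id = fun=> 1); first by move=> x _; exact: cvg_cst.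
  by apply/funext => x; rewrite derive1E derive_val.
have := poincare hx hp C1; rewrite (_ : derive1 id = fun=> 1); last first.
  by apply/funext => x; rewrite derive1E derive_val.
under eq_integral.
  move=> x; rewrite inE => Ix.
  have -> : secant_slope id m1 x = 1.
    rewrite /secant_slope; case: eqVneq => [_|xm]; first by rewrite derive1E derive_val.
    by rewrite divff// subr_eq0.
  rewrite subrr expr0n mulr0 addr0; over.
under [in X in (_ <= X)%E]eq_integral do rewrite expr1n mulr1.
rewrite integral_EFin_Rintegral// variance_centered => low.
have GV : (\int[mu]_(x in I) (G x)%:E = V%:E)%E by apply/eqP; rewrite eq_le up.
split; last by rewrite /Rintegral GV.
apply/integrableP; split.
  by apply/measurable_EFinP; exact: continuous_on_measurable.
under eq_integral => x.
  rewrite inE => Ix; rewrite /= ger0_norm ?(ltW (G0 _ Ix))//; over.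
by rewrite GV ltry.
Qed.

Lemma normalized_integrable (Q : R -> R) : continuous_on I Q ->
  normalized x1 x2 p Q -> mu.-integrable I (EFin \o (fun x => p x * Q x ^+ 2)).
Proof.
move=> cQ nQ; apply/integrableP; split.
  apply/measurable_EFinP; apply: continuous_on_measurable => x Ix.
  apply: continuousM; first exact: density_continuous Ix.
  by apply: continuous_sqr; exact: cQ.
under eq_integral => x.
  rewrite inE => Ix; rewrite /= ger0_norm; last first.
    by apply: mulr_ge0; [exact: ltW (density_gt0 hp Ix)|exact: sqr_ge0].
  over.
by rewrite [X in (X < _)%E]nQ ltry.
Qed.

(** Centering at the mean of the density rather than at the mean value of [Q] costs
    the extra term [Q m1 ^+ 2], which forces [Q m1 = 0] in case of equality. *)
Lemma poincare_centered (Q : R -> R) :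
  continuously_differentiable_on I Q -> normalized x1 x2 p Q ->
  (\int[mu]_(x in I) (p x * Q x)%:E = 0)%E ->
  ((1 + Q m1 ^+ 2)%:E + \int[mu]_(x in I) (G x * (derive1 Q x - secant_slope Q m1 x) ^+ 2)%:E
    <= \int[mu]_(x in I) (G x * derive1 Q x ^+ 2)%:E)%E.
Proof.
move=> CQ nQ mQ; have [dQ cQ'] := CQ.
have cQ : continuous_on I Q.
  by move=> x Ix; apply: differentiable_continuous; apply/derivable1_diffP; exact: dQ.
have iQ2 := normalized_integrable cQ nQ.
have iQ := square_integrable_integrable hp cQ iQ2.
have iQQ : mu.-integrable I (EFin \o (fun x => p x * (Q x * Q x))) by [].
have c0 : mu.-integrable I (EFin \o (fun x => p x * (Q x - Q m1) ^+ 2)).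
  have -> : (fun x => p x * (Q x - Q m1) ^+ 2) =
      (fun x => p x * (1 * Q x ^+ 2 + 1 * (- (2 * Q m1) * Q x + Q m1 ^+ 2 * 1))).
    by apply/funext => x; ring.
  apply: expectation_lin_integrable => //; apply: expectation_lin_integrable => //.
  by under eq_fun do rewrite mulr1; exact: density_integrable.
have EQ2 : E (fun x => (Q x - Q m1) ^+ 2) = 1 + Q m1 ^+ 2.
  rewrite expectation_sqr_sub//.
  have -> : E Q = 0 by rewrite /expectation /Rintegral mQ.
  by rewrite mulr0 subr0; congr (_ + _); rewrite /expectation /Rintegral nQ.
rewrite -EQ2 -integral_EFin_Rintegral// -ge0_integralD//.
- exact: poincare.
- by move=> x Ix; rewrite lee_fin mulr_ge0 ?sqr_ge0// ltW// (density_gt0 hp Ix).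
- by case/integrableP : c0.
- by move=> x Ix; rewrite lee_fin mulr_ge0 ?sqr_ge0// ltW// optimal_weight_gt0.
- apply/measurable_EFinP; apply: continuous_on_measurable => x Ix.
  apply: continuousM; first exact: continuous_optimal_weight.
  apply: continuous_sqr; apply: continuousB; first exact: cQ'.
  exact: continuous_on_secant_slope.
Qed.

Definition has_optimal_conductance (d : diffusion R) :=
  forall x, I x -> conductance p d x = K * G x.

Section optimal_conductance.
Variable d : diffusion R.
Hypothesis dopt : has_optimal_conductance d.

Let a0 x : I x -> 0 < conductance p d x.
Proof. by move=> Ix; rewrite dopt// mulr_gt0 ?optimal_rate_gt0 ?optimal_weight_gt0. Qed.

Let conductanceE x : sigma d x ^+ 2 * p x = 2 * conductance p d x.
Proof. by rewrite /conductance; field. Qed.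

Lemma optimal_conductance_derive x : I x ->
  is_derive x 1 (fun y => sigma d y ^+ 2 * p y) (2 * K * ((m1 - x) * p x)).
Proof.
move=> Ix; apply: (@near_eq_is_derive _ _ _ (fun y => (2 * K) * G y)).
  near=> y; have Iy : I y by near: y; exact: oint_nbhs.
  by rewrite conductanceE dopt// -mulrA.
have dG := is_derive_optimal_weight hx hp Ix.
by apply: is_derive_eq.
Unshelve. all: by end_near. Qed.

Lemma optimal_conductance_cont : continuous_on I (conductance p d).
Proof.
move=> x Ix; have c := is_derive_continuous (optimal_conductance_derive Ix).
have -> : conductance p d = (fun y => 2^-1 * (sigma d y ^+ 2 * p y)).
  by apply/funext => y; rewrite /conductance -mulrA.
by apply: cvgM; [exact: cvg_cst|exact: c].
Qed.

Lemma rayleigh_optimal (Q : R -> R) : continuously_differentiable_on I Q ->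
  (rayleigh x1 x2 p d Q = K%:E * \int[mu]_(x in I) (G x * derive1 Q x ^+ 2)%:E)%E.
Proof.
move=> [_ cQ']; rewrite /rayleigh -ge0_integralZl//.
- apply: eq_integral => x; rewrite inE => Ix; rewrite -EFinM -/(conductance p d x) dopt//.
  by congr EFin; move: K => k; ring.
- apply/measurable_EFinP; apply: continuous_on_measurable => x Ix.
  apply: continuousM; first exact: continuous_optimal_weight.
  by apply: continuous_sqr; exact: cQ'.
- by move=> x Ix; rewrite lee_fin mulr_ge0 ?sqr_ge0// ltW// optimal_weight_gt0.
- by rewrite lee_fin ltW// optimal_rate_gt0.
Qed.

Lemma optimal_lower_bound : rayleigh_lower_bound x1 x2 p d K.
Proof.
move=> Q [CQ nQ mQ _]; rewrite rayleigh_optimal//.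
rewrite -[leLHS]mule1 lee_pmul2l// ?lte_fin ?optimal_rate_gt0//.
apply: le_trans (poincare_centered CQ nQ mQ).
rewrite EFinD -addeA leeDl//; apply: adde_ge0; first by rewrite lee_fin sqr_ge0.
by apply: integral_ge0 => x Ix; rewrite lee_fin mulr_ge0 ?sqr_ge0// ltW// optimal_weight_gt0.
Qed.

Lemma derive1_phi1 : derive1 phi1 = fun=> (Num.sqrt V)^-1.
Proof.
apply/funext => x; rewrite derive1E.
have -> : phi1 = (Num.sqrt V)^-1 \*: (fun y => y - m1) by apply/funext => y /=; rewrite mulrC.
by rewrite deriveZ// derive_val subr0 /GRing.scale /= mulr1.
Qed.

Let sV : Num.sqrt V ^+ 2 = V.
Proof. by rewrite sqr_sqrtr// ltW// variance_gt0. Qed.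

Lemma phi1_derivable (x : R) : is_derive x 1 phi1 (Num.sqrt V)^-1.
Proof.
have -> : phi1 = (Num.sqrt V)^-1 \*: (fun y => y - m1) by apply/funext => y /=; rewrite mulrC.
by apply: is_derive_eq; rewrite subr0 /GRing.scale /= mulr1.
Qed.

Lemma phi1_normalized : normalized x1 x2 p phi1.
Proof.
have V0 := variance_gt0.
rewrite /normalized; have e x : p x * phi1 x ^+ 2 = V^-1 * (p x * (x - m1) ^+ 2).
  by rewrite exprMn exprVn sV; ring.
under eq_integral do rewrite e.
rewrite integral_EFin_Rintegral//; last exact: integrable_scale.
by rewrite RintegralZl// variance_centered mulVf// gt_eqF.
Qed.

Lemma phi1_zero_flux : zero_flux x1 x2 p d phi1.
Proof.
have fE x : I x -> flux p d phi1 x = K * (Num.sqrt V)^-1 * G x.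
  by move=> Ix; rewrite /flux derive1_phi1 -/(conductance p d x) dopt// mulrAC.
have [c [_ [Ic _ _]]] := oint_ex hx.
split; rewrite -(mulr0 (K * (Num.sqrt V)^-1)).
- apply: (@cvg_trans _ ((fun x => K * (Num.sqrt V)^-1 * G x) @ to_left_end x1)).
    by apply: near_eq_cvg; apply: filterS (near_left_end Ic) => x [Ix _]; rewrite fE.
  by apply: cvgM; [exact: cvg_cst|exact: optimal_weight_left_end].
- apply: (@cvg_trans _ ((fun x => K * (Num.sqrt V)^-1 * G x) @ to_right_end x2)).
    by apply: near_eq_cvg; apply: filterS (near_right_end Ic) => x [Ix _]; rewrite fE.
  by apply: cvgM; [exact: cvg_cst|exact: optimal_weight_right_end].
Qed.

Lemma phi1_C1 : continuously_differentiable_on I phi1.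
Proof.
split; first by move=> x _; case: (phi1_derivable x).
by rewrite derive1_phi1 => x _; exact: cvg_cst.
Qed.

Lemma phi1_competitor : rayleigh_competitor x1 x2 p d phi1.
Proof.
split; [exact: phi1_C1|exact: phi1_normalized| |exact: phi1_zero_flux].
have i1 : mu.-integrable I (EFin \o (fun x => p x * (x - m1))) by exact: density_integrable1.
under eq_integral do rewrite mulrA mulrC.
rewrite integral_EFin_Rintegral//; last exact: integrable_scale.
by rewrite RintegralZl// (expectation_centered hp) mulr0.
Qed.

Lemma optimal_convergence_rate : convergence_rate x1 x2 p d K.
Proof.
have V0 := variance_gt0; have [iG GV] := optimal_weight_integral.
split; last exact: optimal_lower_bound.
exists phi1; first exact: phi1_competitor.
rewrite rayleigh_optimal; last exact: phi1_C1.
rewrite derive1_phi1; under eq_integral do rewrite exprVn sV mulrC.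
rewrite integral_EFin_Rintegral//; last exact: integrable_scale.
by rewrite RintegralZl// GV mulVf ?gt_eqF// mule1.
Qed.

Lemma phi1_eigenfunction : normalized_eigenfunction x1 x2 p d K phi1.
Proof.
have V0 := variance_gt0.
have e : (fun y => p y * sigma d y ^+ 2 * derive1 phi1 y) =
    (Num.sqrt V)^-1 \*: (fun y => sigma d y ^+ 2 * p y).
  by apply/funext => y /=; rewrite derive1_phi1 mulrC [p y * _]mulrC.
have de x : I x -> is_derive x 1 (fun y => p y * sigma d y ^+ 2 * derive1 phi1 y)
    ((Num.sqrt V)^-1 *: (2 * K * ((m1 - x) * p x))).
  by move=> Ix; rewrite e; apply: is_deriveZ; exact: optimal_conductance_derive.
split.
- by move=> x _; case: (phi1_derivable x).
- by move=> x /de [].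
- move=> x /de h; rewrite derive1E derive_val /GRing.scale /=.
  by move: K => k; field; rewrite gt_eqF// sqrtr_gt0.
- exact: phi1_zero_flux.
- exact: phi1_normalized.
Qed.

Section any_eigenfunction.
Variables (l : R) (phi : R -> R).
Hypotheses (l0 : 0 < l) (ephi : normalized_eigenfunction x1 x2 p d l phi).

Let dphi x : I x -> is_derive x 1 phi (derive1 phi x).
Proof. by case: ephi => h _ _ _ _ Ix; apply: DeriveDef; [exact: h|rewrite derive1E]. Qed.

Let cphi : continuous_on I phi.
Proof. by move=> x Ix; exact: is_derive_continuous (dphi Ix). Qed.

Let fluxE x : I x ->
  is_derive x 1 (fun y => conductance p d y * derive1 phi y) (- (l * p x * phi x)).
Proof.
case: ephi => _ dflux ode _ _ Ix.
have -> : (fun y => conductance p d y * derive1 phi y) =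
    2^-1 \*: (fun y => p y * sigma d y ^+ 2 * derive1 phi y).
  by apply/funext => y /=; rewrite /conductance /GRing.scale /=; ring.
have -> : - (l * p x * phi x) = 2^-1 *: derive1 (fun y => p y * sigma d y ^+ 2 * derive1 phi y) x.
  by have := ode x Ix; rewrite /GRing.scale /= => /eqP; rewrite addr_eq0 => /eqP ->.
by apply: is_deriveZ; apply: DeriveDef; [exact: dflux|rewrite derive1E].
Qed.

Let iphi2 : mu.-integrable I (EFin \o (fun x => p x * phi x ^+ 2)).
Proof. by case: ephi => _ _ _ _; exact: normalized_integrable. Qed.

Lemma eigenfunction_competitor : rayleigh_competitor x1 x2 p d phi.
Proof.
case: (ephi) => h1 h2 h3 [fl fr] nphi.
split; [|exact: nphi| |by split].
- split; first exact: h1.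
  exact: (eigenfunction_C1 optimal_conductance_cont a0 fluxE).
- rewrite integral_EFin_Rintegral//; last exact: square_integrable_integrable cphi iphi2.
  have := eigenfunction_mean hx hp dphi fluxE fl fr iphi2.
  by move/eqP; rewrite mulf_eq0 gt_eqF//= => /eqP ->.
Qed.

Lemma eigenfunction_rayleigh_le : (rayleigh x1 x2 p d phi <= l%:E)%E.
Proof.
case: (ephi) => h1 h2 h3 [fl fr] nphi.
have := eigenfunction_energy hx hp optimal_conductance_cont a0 dphi fluxE fl fr (ltW l0) iphi2.
by rewrite [X in l * X](_ : _ = 1) ?mulr1// /Rintegral [X in fine X]nphi.
Qed.

Lemma eigenvalue_ge_optimal : K <= l.
Proof.
rewrite -lee_fin; apply: le_trans eigenfunction_rayleigh_le.
exact: optimal_lower_bound eigenfunction_competitor.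
Qed.

(** Equality must hold in [poincare_centered]: then [phi] vanishes at the mean and
    its secant slope from the mean equals its derivative, so that the slope is
    constant. *)
Lemma eigenfunction_unique : l = K ->
  (forall x, I x -> phi x = phi1 x) \/ (forall x, I x -> phi x = - phi1 x).
Proof.
move=> lK; have V0 := variance_gt0.
have [CQ nQ mQ _] := eigenfunction_competitor.
have Im := mean_in hx hp.
have := eigenfunction_rayleigh_le; rewrite rayleigh_optimal// lK.
rewrite -[leRHS]mule1 lee_pmul2l// ?lte_fin ?optimal_rate_gt0//.
move=> /(le_trans (poincare_centered CQ nQ mQ)).
set D := (\int[mu]_(x in I) _)%E.
have cr := continuous_on_secant_slope hx hp CQ.
have cD : continuous_on I (fun x => G x * (derive1 phi x - secant_slope phi m1 x) ^+ 2).
  move=> x Ix; apply: continuousM; first exact: continuous_optimal_weight.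
  by apply: continuous_sqr; apply: continuousB; [case: CQ => _; exact|exact: cr].
have Dx0 x : I x -> 0 <= G x * (derive1 phi x - secant_slope phi m1 x) ^+ 2.
  by move=> Ix; rewrite mulr_ge0 ?sqr_ge0// ltW// optimal_weight_gt0.
have D0 : (0 <= D)%E by apply: integral_ge0 => x Ix; rewrite lee_fin; exact: Dx0.
move=> hD.
have Dfin : D \is a fin_num.
  rewrite ge0_fin_numE//; apply: (@le_lt_trans _ _ ((1 + phi m1 ^+ 2)%:E + D)%E); last first.
    by apply: le_lt_trans hD _; rewrite ltry.
  by rewrite leeDr// lee_fin addr_ge0 ?sqr_ge0.
move: hD; rewrite -(fineK Dfin) -EFinD lee_fin => hD.
have fD0 : 0 <= fine D by rewrite fine_ge0.
have phim2 : phi m1 ^+ 2 = 0 by apply/eqP; rewrite eq_le sqr_ge0 andbT; lra.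
have phim : phi m1 = 0 by apply/eqP; rewrite -sqrf_eq0 phim2.
have D_eq0 : fine D = 0 by have := sqr_ge0 (phi m1); lra.
have iD : mu.-integrable I (EFin \o (fun x => G x * (derive1 phi x - secant_slope phi m1 x) ^+ 2)).
  apply/integrableP; split; first by apply/measurable_EFinP; exact: continuous_on_measurable.
  under eq_integral => x.
    by rewrite inE => Ix; rewrite /= ger0_norm ?Dx0//; over.
  by rewrite -/D ltey_eq Dfin.
have slope x : I x -> derive1 phi x = secant_slope phi m1 x.
  move=> Ix; apply/eqP; rewrite -subr_eq0; apply/negPn/negP => nz.
  have pos : 0 < G x * (derive1 phi x - secant_slope phi m1 x) ^+ 2.
    by rewrite mulr_gt0 ?optimal_weight_gt0// exprn_even_gt0.
  have fpos : \forall y \near x, 0 < G y * (derive1 phi y - secant_slope phi m1 y) ^+ 2.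
    exact: (cvgr_gt _ (cD _ Ix) _ pos).
  have : \forall y \near x, 0 < G y * (derive1 phi y - secant_slope phi m1 y) ^+ 2 /\ I y.
    by apply: filterS2 fpos (oint_nbhs Ix) => y; split.
  move=> /nbhs_ballP[e /= e0 he].
  have bx y : x - e / 2 <= y <= x + e / 2 -> ball x e y.
    by move=> ?; rewrite /ball /= ltr_distlC; apply/andP; split; lra.
  suff : 0 < fine D by rewrite D_eq0 ltxx.
  apply: (@Rintegral_gt0 R I _ (x - e / 2) (x + e / 2)) => //.
  - lra.
  - by move=> y /=; rewrite in_itv /= => /bx/he[].
  - by move=> y /bx/he[? Iy]; split => //; exact: cD.
(* away from m1 the derivative of the slope is (phi' - slope) / (x - m1) = 0 *)
pose c := secant_slope phi m1 m1.
have dr0 x : I x -> x != m1 -> is_derive x 1 (secant_slope phi m1) 0.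
  move=> Ix xm; have := is_derive_secant_slope xm (dphi Ix).
  by rewrite slope// subrr mul0r.
have rc x : I x -> secant_slope phi m1 x = c.
  move=> Ix; have [xm|xm|->//] := ltgtP x m1.
  - have := @MVT_segment R (secant_slope phi m1) (fun=> 0) x m1 (ltW xm).
    case.
    + move=> y; rewrite in_itv /= => /andP[xy ym]; apply: dr0; last by rewrite lt_eqF.
      by apply: (oint_between Ix Im); rewrite !ltW.
    + by apply: continuous_itv_within => y /(oint_between Ix Im); exact: cr.
    by move=> y _ /eqP; rewrite mul0r subr_eq0 => /eqP <-.
  - have := @MVT_segment R (secant_slope phi m1) (fun=> 0) m1 x (ltW xm).
    case.
    + move=> y; rewrite in_itv /= => /andP[my yx]; apply: dr0; last by rewrite gt_eqF.
      by apply: (oint_between Im Ix); rewrite !ltW.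
    + by apply: continuous_itv_within => y /(oint_between Im Ix); exact: cr.
    by move=> y _ /eqP; rewrite mul0r subr_eq0 => /eqP ->.
have phiE x : I x -> phi x = c * (x - m1).
  by move=> Ix; rewrite -(rc _ Ix) -secant_slopeE phim subr0.
have c2 : c ^+ 2 = ((Num.sqrt V)^-1) ^+ 2.
  rewrite exprVn sV; apply: (mulIf (x := V)); first by rewrite gt_eqF.
  rewrite mulVf ?gt_eqF// -[in LHS]variance_centered -RintegralZl//.
  have -> : 1 = \int[mu]_(x in I) (p x * phi x ^+ 2) by rewrite /Rintegral [X in fine X]nQ.
  by apply: eq_Rintegral => x; rewrite inE => Ix; rewrite phiE// exprMn mulrCA.
move/eqP: c2; rewrite eqf_sqr => /orP[]/eqP cE; [left|right] => x Ix.
- by rewrite phiE// cE mulrC.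
- by rewrite phiE// cE mulNr mulrC.
Qed.

End any_eigenfunction.

Lemma optimal_next_eigenvalue : next_eigenvalue x1 x2 p d K.
Proof.
split; first exact: optimal_rate_gt0.
- by exists phi1; exact: phi1_eigenfunction.
- by move=> l' [phi ephi] l'0; exact: eigenvalue_ge_optimal l'0 ephi.
Qed.

Lemma optimal_admissible : admissible x1 x2 p sh2 d.
Proof.
have V0 := variance_gt0; have [iG GV] := optimal_weight_integral.
split.
- move=> x Ix; have := a0 Ix; rewrite /conductance pmulr_lgt0 ?(density_gt0 hp Ix)//.
  by rewrite pmulr_rgt0.
- split; first by move=> x /optimal_conductance_derive[].
  move=> x Ix; rewrite /continuous_at.
  have c : {for x, continuous (fun y => 2 * K * ((m1 - y) * p y))}.
    apply: cvgM; first exact: cvg_cst.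
    apply: cvgM; last exact: density_continuous Ix.
    by apply: cvgB; [exact: cvg_cst|exact: cvg_id].
  have e y : I y -> derive1 (fun x => sigma d x ^+ 2 * p x) y = 2 * K * ((m1 - y) * p y).
    by move=> /optimal_conductance_derive h; rewrite derive1E derive_val.
  rewrite /prop_for /continuous_at e//; apply: cvg_trans c; apply: near_eq_cvg.
  by apply: filterS (oint_nbhs Ix) => y /e.
- have <- : (\int[mu]_(x in I) (K * G x)%:E = (2^-1 * sh2)%:E)%E.
    rewrite integral_EFin_Rintegral//; last exact: integrable_scale.
    by rewrite RintegralZl// GV; congr EFin; field; rewrite gt_eqF.
  by apply: eq_integral => x; rewrite inE => Ix; rewrite -dopt.
- by exists K; exact: optimal_convergence_rate.
Qed.

End optimal_conductance.

Lemma admissible_conductance d : admissible x1 x2 p sh2 d ->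
  [/\ forall x, I x -> 0 <= conductance p d x, continuous_on I (conductance p d),
      mu.-integrable I (EFin \o conductance p d) &
      \int[mu]_(x in I) conductance p d x = 2^-1 * sh2].
Proof.
move=> [sig0 [dsp _] avg _].
have a0 x : I x -> 0 <= conductance p d x.
  by move=> Ix; rewrite mulr_ge0 ?(ltW (density_gt0 hp Ix))// mulr_ge0// ltW// sig0.
have ca : continuous_on I (conductance p d).
  move=> x Ix; have -> : conductance p d = (fun y => 2^-1 * (sigma d y ^+ 2 * p y)).
    by apply/funext => y; rewrite /conductance -mulrA.
  have c : {for x, continuous (fun y => sigma d y ^+ 2 * p y)}.
    by apply: differentiable_continuous; apply/derivable1_diffP; exact: dsp.
  by apply: cvgM; [exact: cvg_cst|exact: c].
split => //; last by rewrite /Rintegral [X in fine X]avg.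
apply/integrableP; split; first by apply/measurable_EFinP; exact: continuous_on_measurable.
under eq_integral => x.
  by rewrite inE => Ix; rewrite /= ger0_norm ?a0//; over.
by rewrite [X in (X < _)%E]avg ltry.
Qed.

(** The identity has derivative one, so its Rayleigh integral is the average
    variance. *)
Lemma convergence_rate_le d l : admissible x1 x2 p sh2 d ->
  convergence_rate x1 x2 p d l -> l <= K.
Proof.
move=> adm [_ LB]; have V0 := variance_gt0.
have [a0 ca ia avg] := admissible_conductance adm.
have := @rayleigh_variance R x1 x2 p hx hp d l ia a0 LB id (fun=> 1) 1.
rewrite variance_id; under eq_Rintegral do rewrite expr1n mulr1.
rewrite avg => h; have : l * V <= 2^-1 * sh2.
  by apply: h => [x|_]; [exact: cvg_cst|rewrite normr1].
have -> : 2^-1 * sh2 = K * V by field; rewrite gt_eqF.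
by rewrite ler_pM2r.
Qed.

Definition optimum : diffusion R :=
  Diffusion (fun x => sh2 * (m1 - x) / (2 * V))
            (fun x => Num.sqrt (2 * K * G x / p x)).

Lemma optimum_conductance : has_optimal_conductance optimum.
Proof.
move=> x Ix; have p0 := density_gt0 hp Ix; have G0 := optimal_weight_gt0 hx hp Ix.
have K0 := optimal_rate_gt0.
rewrite /conductance /= sqr_sqrtr; last first.
  apply: divr_ge0; last exact: ltW.
  by apply: mulr_ge0; [apply: mulr_ge0 => //; exact: ltW|exact: ltW].
by rewrite -mulrA divfK ?gt_eqF//; move: K => k; field.
Qed.

Lemma reversible_drift d : has_optimal_conductance d ->
  reversible x1 x2 p d <->
  forall x, I x -> drift d x = sh2 * (m1 - x) / (2 * V).
Proof.
move=> dopt; have V0 := variance_gt0.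
have e x : I x -> 2^-1 * derive1 (fun y => sigma d y ^+ 2 * p y) x =
    sh2 * (m1 - x) / (2 * V) * p x.
  move=> /(optimal_conductance_derive dopt) h; rewrite derive1E derive_val.
  by field; rewrite gt_eqF.
split=> h x Ix.
- have p0 := density_gt0 hp Ix; have := h x Ix; rewrite e// mulNr addrC => /eqP.
  by rewrite subr_eq0 => /eqP/mulIf; rewrite gt_eqF// => /(_ isT).
- by rewrite e// h// mulNr addNr.
Qed.

Lemma optimum_optimal : optimal_diffusion x1 x2 p sh2 optimum K.
Proof.
have oc := optimum_conductance; split.
- by apply/(reversible_drift oc) => x _.
- exact: optimal_admissible.
- exact: optimal_convergence_rate.
- by move=> d' l' _ adm rate; exact: convergence_rate_le adm rate.
Qed.

(** The rate is squeezed between the upper bound and the rate of [optimum]; then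
    both conductances have the optimal rate and the same integral. *)
Lemma optimal_diffusion_unique d l : optimal_diffusion x1 x2 p sh2 d l ->
  l = K /\ has_optimal_conductance d.
Proof.
move=> [rev adm rate best].
have [orev oadm orate _] := optimum_optimal.
have lK : l = K.
  by apply/eqP; rewrite eq_le (convergence_rate_le adm rate) (best _ _ orev oadm orate).
split=> // x Ix; rewrite -(optimum_conductance Ix).
have [a0 ca ia avg] := admissible_conductance adm.
have [oa0 oca oia oavg] := admissible_conductance oadm.
have V0 := variance_gt0.
have KV : 2^-1 * sh2 = K * variance_of x1 x2 p id by rewrite variance_id; field; rewrite gt_eqF.
rewrite lK in rate; case: rate => _ LB; case: orate => _ oLB.
by apply: (conductance_unique hx hp (l := K)) => //; rewrite -KV.
Qed.

End Optimum.

Theorem theorem1 (R : realType) (x1 x2 : \bar R) (p : R -> R) (sh2 : R)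
    (hx : (x1 < x2)%E) (hp : stationary_density x1 x2 p) (hs : 0 < 2^-1 * sh2) :
  let m1 := moment x1 x2 p 1 in
  let m2 := moment x1 x2 p 2 in
  let P := integral_from x1 p in
  let phi1 := fun x : R => (x - m1) / Num.sqrt (m2 - m1 ^+ 2) in
  [/\ (exists (d : diffusion R) (l : R), optimal_diffusion x1 x2 p sh2 d l),
      (forall (d : diffusion R) (l : R), optimal_diffusion x1 x2 p sh2 d l ->
        [/\ l = sh2 / (2 * (m2 - m1 ^+ 2)) /\
            relaxation_time l = 2 * (m2 - m1 ^+ 2) / sh2,
            (forall x, oint x1 x2 x ->
               drift d x = sh2 * (m1 - x) / (2 * (m2 - m1 ^+ 2))),
            (forall x, oint x1 x2 x ->
               variance_function d x =
                 1 / p x * (sh2 / (2 * (m2 - m1 ^+ 2))) *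
                 ((m1 - x) * P x + integral_from x1 P x)),
            next_eigenvalue x1 x2 p d l &
            normalized_eigenfunction x1 x2 p d l phi1 /\
            (forall phi, normalized_eigenfunction x1 x2 p d l phi ->
               (forall x, oint x1 x2 x -> phi x = phi1 x) \/
               (forall x, oint x1 x2 x -> phi x = - phi1 x))]) &
      (forall (d : diffusion R) (l : R),
         reversible x1 x2 p d -> admissible x1 x2 p sh2 d ->
         convergence_rate x1 x2 p d l ->
         l <= sh2 / (2 * (m2 - m1 ^+ 2)))].
Proof.
move=> m1 m2 P phi1; split.
- exists (optimum x1 x2 p sh2), (sh2 / (2 * (m2 - m1 ^+ 2))).
  exact: optimum_optimal.
- move=> d l dl; have [lK dopt] := optimal_diffusion_unique hx hp hs dl.
  have K0 := optimal_rate_gt0 hx hp hs.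
  have [rev _ _ _] := dl; rewrite lK; split.
  + by split=> //; rewrite /relaxation_time invf_div.
  + exact: (proj1 (reversible_drift hx hp dopt) rev).
  + move=> x Ix; have p0 := density_gt0 hp Ix.
    rewrite -optimal_weightE// -mulrA -dopt// div1r /conductance mulrCA mulrC.
    by rewrite mulVf ?gt_eqF// mul1r.
  + exact: optimal_next_eigenvalue.
  + split; first exact: phi1_eigenfunction.
    by move=> phi ephi; exact: (eigenfunction_unique hx hp hs dopt K0 ephi erefl).
- by move=> d l _; exact: convergence_rate_le.
Qed.
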